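(* Suppose $n\le m$. If $\mu=\mathcal{N}(m_0,\Sigma_0)$ is a Gaussian measure on $\mathbb{R}^m$ and $\nu=\mathcal{N}(m_1,\Sigma_1)$ is a Gaussian measure on $\mathbb{R}^n$, then $$GGW_2^2(\mu,\nu)-LGW_2^2(\mu,\nu)\ \le\ 8\|\Sigma_0\|_{\mathcal{F}}\|\Sigma_1\|_{\mathcal{F}}\left(1-\frac{1}{\sqrt m}\right).$$
   Context: $\|M\|_{\mathcal{F}}=\sqrt{\mathrm{tr}(M^TM)}$ is the Frobenius norm. $$GGW_2^2(\mu,\nu)=\inf_{\pi\in\Pi(\mu,\nu)\cap\mathcal{N}_{m+n}}\int\int\left(\|x-x'\|_{\mathbb{R}^m}^2-\|y-y'\|_{\mathbb{R}^n}^2\right)^2d\pi(x,y)\,d\pi(x',y'),$$ where $\Pi(\mu,\nu)$ is the set of probability measures on $\mathbb{R}^m\times\mathbb{R}^n$ with marginals $\mu,\nu$ and $\mathcal{N}_{m+n}$ is the set of (possibly degenerate) Gaussian measures on $\mathbb{R}^{m+n}$. With diagonalizations $\Sigma_0=P_0D_0P_0^T$, $\Sigma_1=P_1D_1P_1^T$ ($P_0,P_1$ orthogonal, $D_0,D_1$ diagonal with eigenvalues in non-increasing order) and $n\le m$, $$LGW_2^2(\mu,\nu)=4\left(\mathrm{tr}(D_0)-\mathrm{tr}(D_1)\right)^2+4\left(\|D_0\|_{\mathcal{F}}-\|D_1\|_{\mathcal{F}}\right)^2+4\|D_0^{(n)}-D_1\|_{\mathcal{F}}^2+4\left(\|D_0\|_{\mathcal{F}}^2-\|D_0^{(n)}\|_{\mathcal{F}}^2\right),$$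 where $D_0^{(n)}$ is the submatrix of the first $n$ rows and $n$ columns of $D_0$. *)

(* Defs.v *)
From mathcomp Require Import all_boot all_order all_algebra.
From mathcomp Require Import all_classical all_reals all_analysis.

Set Implicit Arguments.
Unset Strict Implicit.
Unset Printing Implicit Defensive.

Import Order.TTheory GRing.Theory Num.Theory.

Local Open Scope classical_set_scope.
Local Open Scope ring_scope.

(* [R^d] is [d.-tuple R], whose canonical sigma-algebra is the product of the
   Borel ones, i.e. the Borel sigma-algebra of [R^d]. *)

Definition colvec (R : realType) (d : nat) (x : d.-tuple R) : 'cV[R]_d :=
  \col_i tnth x i.

Definition dotv (R : realType) (d : nat) (u v : 'cV[R]_d) : R :=
  (u^T *m v) ord0 ord0.

Definition enorm (R : realType) (d : nat) (u : 'cV[R]_d) : R :=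
  Num.sqrt (dotv u u).

(* [N(a, v)] on the line, [v] being the variance. The case [v = 0] has to be
   split off: [normal_prob a 0] is not the Dirac mass (it is uniform on
   [0, 1]). *)
Definition normal1 (R : realType) (a v : R) (A : set R) : \bar R :=
  if v == 0 then dirac a A else normal_prob a (Num.sqrt v) A.

(* [mu = N(a, S)], possibly degenerate: under [mu], each linear form
   [x |-> u^T x] has law [N(u^T a, u^T S u)]. *)
Definition is_gaussian (R : realType) (d : nat)
    (mu : set (d.-tuple R) -> \bar R) (a : 'cV[R]_d) (S : 'M[R]_d) : Prop :=
  [/\ S^T = S,
      (forall u : 'cV[R]_d, 0 <= dotv u (S *m u)) &
      forall (u : 'cV[R]_d) (A : set R), measurable A ->
        mu [set x | A (dotv u (colvec x))]
        = normal1 (dotv u a) (dotv u (S *m u)) A].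

Definition is_coupling (R : realType) (m n : nat)
    (mu : probability (m.-tuple R) R) (nu : probability (n.-tuple R) R)
    (pi : probability (m.-tuple R * n.-tuple R)%type R) : Prop :=
  (forall A, measurable A -> pi (A `*` setT) = mu A) /\
  (forall B, measurable B -> pi (setT `*` B) = nu B).

(* [pi] is transported to [R^(m + n)] by concatenation of coordinates. *)
Definition jointly_gaussian (R : realType) (m n : nat)
    (pi : probability (m.-tuple R * n.-tuple R)%type R) : Prop :=
  exists (a : 'cV[R]_(m + n)) (S : 'M[R]_(m + n)),
    is_gaussian
      (pushforward pi (fun z : m.-tuple R * n.-tuple R =>
                         [tuple of z.1 ++ z.2])) a S.

Definition gw_cost (R : realType) (m n : nat)
    (pi : probability (m.-tuple R * n.-tuple R)%type R) : \bar R :=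
  (\int[pi]_z \int[pi]_z'
     ((enorm (colvec z.1 - colvec z'.1) ^+ 2
       - enorm (colvec z.2 - colvec z'.2) ^+ 2) ^+ 2)%:E)%E.

(* This is [GGW_2^2], not [GGW_2]. *)
Definition GGW2sq (R : realType) (m n : nat)
    (mu : probability (m.-tuple R) R) (nu : probability (n.-tuple R) R)
    : \bar R :=
  ereal_inf [set gw_cost pi | pi in
    [set pi : probability (m.-tuple R * n.-tuple R)%type R |
      is_coupling mu nu pi /\ jointly_gaussian pi]].

Definition frobenius (R : realType) (p q : nat) (M : 'M[R]_(p, q)) : R :=
  Num.sqrt (\tr (M^T *m M)).

Definition ordered_diagonalization (R : realType) (d : nat)
    (S P D : 'M[R]_d) : Prop :=
  [/\ S = P *m D *m P^T, P^T *m P = 1%:M, is_diag_mx D &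
      forall i j : 'I_d, (i <= j)%N -> D j j <= D i i].

Definition lead_submx (R : realType) (m n : nat) (hnm : (n <= m)%N)
    (D : 'M[R]_m) : 'M[R]_n :=
  mxsub (widen_ord hnm) (widen_ord hnm) D.

(* This is [LGW_2^2] as a function of the ordered diagonal forms of the two
   covariance matrices; these are determined by the covariances. *)
Definition LGW2sq (R : realType) (m n : nat) (hnm : (n <= m)%N)
    (D0 : 'M[R]_m) (D1 : 'M[R]_n) : R :=
  4 * (\tr D0 - \tr D1) ^+ 2
  + 4 * (frobenius D0 - frobenius D1) ^+ 2
  + 4 * frobenius (lead_submx hnm D0 - D1) ^+ 2
  + 4 * (frobenius D0 ^+ 2 - frobenius (lead_submx hnm D0) ^+ 2).

(* Main.v *)
Require Import Defs.
From mathcomp Require Import all_boot all_order all_algebra.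
From mathcomp Require Import all_classical all_reals all_analysis.
From mathcomp Require Import measurable_realfun.
From mathcomp Require Import ring lra.

(** The infimum is bounded by the cost of a single Gaussian coupling.  Let [Z]
be a standard Gaussian vector of [R^m] and take
[X = m0 + P0 sqrt(D0) Z] and [Y = m1 + P1 sqrt(D1) (Z_1, ..., Z_n)], so that in
the eigenbases the [i]-th coordinate of [Y] is driven by the same noise as the
[i]-th coordinate of [X].  If [w = Z - Z'] is the difference of two independent
copies, [P0] and [P1] being isometries, the cost of this coupling is the mean of
[(sum_i c_i w_i^2)^2], where [c_i = d0_i - d1_i] and the spectrum of [Sigma1]
is padded with zeros.  Its value is [4 ((sum_i c_i)^2 + 2 sum_i c_i^2)], and
subtracting [LGW_2^2] leaves
[8 (|D0| |D1| - sum_i d0_i d1_i)] ([gw_identity]).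
Both spectra are nonnegative and sorted the same way, which forces
[|D0| |D1| <= sqrt m * sum_i d0_i d1_i] ([sorted_inner_product_ge]); this is the
factor [1 - 1 / sqrt m].

Two facts about Gaussian laws support this computation.

The pair [(X, Y)] is a coupling of [mu] and [nu] only if the laws of [X] and [Y]
are [mu] and [nu], whereas being Gaussian is expressed through linear
forms.  This is the Cramer-Wold theorem ([cramer_wold]): two laws under which
every linear form has the same law give the same mean to every function [cos (u . x + c)], hence to
their linear combinations, which form an algebra; explicit elements of that
algebra converge boundedly to the indicators of the quadrants
[{x | x_i < b_i for all i}], and quadrants generate the Borel sets.  The
existence of [Z] is obtained by adding coordinates one at a time, from the
fact that [p G + q G'] has the law of [sqrt (p^2 + q^2) G] when [G] and [G'] are
independent normal variables ([stdN_conv]), which is a completion of squares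
followed by Tonelli's theorem.

The mean of the quartic form is read off from
[12 a^2 b^2 = (a + b)^4 + (a - b)^4 - 2 a^4 - 2 b^4]: it reduces to fourth
moments of linear forms of [w], all of which are multiples of the fourth moment
[k] of the normal law.  The cost is thus [k / 3] times the value announced
above, a nonnegative number, and the bound [k <= 3] suffices
([stdN_moment4_le3]). *)

Set Implicit Arguments.
Unset Strict Implicit.
Unset Printing Implicit Defensive.

Import Order.TTheory GRing.Theory Num.Theory.
Import numFieldNormedType.Exports.

Local Open Scope classical_set_scope.
Local Open Scope ring_scope.

(** * Euclidean vectors *)

Section euclidean.
Context {R : realType} {d : nat}.
Implicit Types u v x : 'cV[R]_d.

Lemma dotvE u v : dotv u v = \sum_i u i ord0 * v i ord0.
Proof. by rewrite /dotv mxE; apply: eq_bigr => i _; rewrite mxE. Qed.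

Lemma dotvC u v : dotv u v = dotv v u.
Proof. by rewrite !dotvE; apply: eq_bigr => i _; rewrite mulrC. Qed.

Lemma dotvDl u v x : dotv (u + v) x = dotv u x + dotv v x.
Proof. by rewrite /dotv linearD /= mulmxDl mxE. Qed.

Lemma dotvZl c u x : dotv (c *: u) x = c * dotv u x.
Proof. by rewrite /dotv linearZ /= -scalemxAl mxE. Qed.

Lemma dotvDr u v x : dotv x (u + v) = dotv x u + dotv x v.
Proof. by rewrite dotvC dotvDl !(dotvC x). Qed.

Lemma dotvZr c u x : dotv x (c *: u) = c * dotv x u.
Proof. by rewrite dotvC dotvZl !(dotvC x). Qed.

Lemma dotv_deltal (i : 'I_d) u : dotv (delta_mx i ord0) u = u i ord0.
Proof.
rewrite dotvE (bigD1 i)//= big1 ?addr0.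
  by rewrite !mxE !eqxx mul1r.
by move=> j ji; rewrite !mxE (negbTE ji) mul0r.
Qed.

Lemma dotv_delta_colvec (i : 'I_d) (x : d.-tuple R) :
  dotv (delta_mx i ord0) (colvec x) = tnth x i.
Proof. by rewrite dotv_deltal mxE. Qed.

Lemma dotv_ge0 u : 0 <= dotv u u.
Proof. by rewrite dotvE sumr_ge0// => i _; rewrite -expr2 sqr_ge0. Qed.

Lemma sqr_enorm u : enorm u ^+ 2 = dotv u u.
Proof. by rewrite sqr_sqrtr// dotv_ge0. Qed.

Lemma measurable_dotv u :
  measurable_fun setT (fun x : d.-tuple R => dotv u (colvec x)).
Proof.
rewrite (_ : (fun _ => _) = fun x : d.-tuple R => \sum_i u i ord0 * tnth x i).
  apply: measurable_sum => i; apply: measurable_funM => //.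
  exact: measurable_tnth.
by apply/funext => x; rewrite dotvE; apply: eq_bigr => i _; rewrite !mxE.
Qed.

End euclidean.

(** * Laws of images *)

Section image_law.
Context {d d' : measure_display} {T : measurableType d} {T' : measurableType d'}
  {R : realType}.

(** Unlike the bare pushforward, this carries the structure of a probability
measure, obtained from the measurability of [f]. *)
Definition image_law (P : probability T R) (f : T -> T')
    (mf : measurable_fun setT f) : probability T' R :=
  distribution P (MeasurableFun.Pack (MeasurableFun.Class
    (isMeasurableFun.Build _ _ _ _ _ mf)) : {mfun T >-> T'}).

Variables (P : probability T R) (f : T -> T') (mf : measurable_fun setT f).

Lemma image_lawE A : image_law P mf A = P (f @^-1` A).
Proof. by []. Qed.

Lemma ge0_integral_image_law (g : T' -> \bar R) :
  measurable_fun setT g -> (forall y, (0 <= g y)%E) ->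
  (\int[image_law P mf]_y g y = \int[P]_x g (f x))%E.
Proof. by move=> mg g0; rewrite ge0_integral_distribution. Qed.

Lemma integral_image_law (g : T' -> \bar R) :
  measurable_fun setT g -> P.-integrable setT (g \o f) ->
  (\int[image_law P mf]_y g y = \int[P]_x g (f x))%E.
Proof. by move=> mg g0; rewrite integral_distribution. Qed.

End image_law.

(** * The Cramer-Wold theorem *)

Lemma bernoulli_ineq (R : realDomainType) (x : R) n :
  -1 <= x -> 1 + n%:R * x <= (1 + x) ^+ n.
Proof.
move=> x1; elim: n => [|n ih]; first by rewrite mul0r addr0 expr0.
rewrite exprS; have x0 : 0 <= 1 + x by lra.
apply: le_trans (ler_wpM2l x0 ih).
by rewrite -natr1; have := ler0n R n; have := sqr_ge0 x; nra.
Qed.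

(** With [y = sqrt x], Bernoulli's inequality for [1 / y] bounds [n y^n] by a
constant, so that [n x^n = (n y^n) y^n] is dominated by a geometric sequence. *)
Lemma cvg_natM_expr (R : realType) (x : R) :
  0 <= x -> x < 1 -> n%:R * x ^+ n @[n --> \oo] --> 0.
Proof.
move=> x0 x1; have [->|xn0] := eqVneq x 0.
  rewrite (_ : (fun n => _) = cst 0); first exact: cvg_cst.
  by apply/funext => -[|n]; rewrite ?mul0r//= expr0n mulr0.
have xp : 0 < x by rewrite lt_neqAle eq_sym xn0.
pose y := Num.sqrt x.
have y0 : 0 < y by rewrite sqrtr_gt0.
have y1 : y < 1 by rewrite -sqrtr1 ltr_sqrt// ltr01.
have yx : y ^+ 2 = x by rewrite sqr_sqrtr.
have h0 : 0 < y^-1 - 1 by rewrite subr_gt0 invf_gt1.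
have bnd n : n%:R * x ^+ n <= (y^-1 - 1)^-1 * y ^+ n.
  rewrite -yx -exprM mul2n -addnn exprD mulrA.
  apply: ler_wpM2r; first by rewrite exprn_ge0 ?ltW.
  rewrite -[leRHS]mul1r ler_pdivlMr//.
  have H : 1 + n%:R * (y^-1 - 1) <= (y ^+ n)^-1.
    have /(bernoulli_ineq n) : -1 <= y^-1 - 1 by lra.
    by rewrite (addrC 1 (_ - 1)) subrK exprVn.
  rewrite -[leRHS](@mulfV _ (y ^+ n)) ?expf_neq0 ?gt_eqF//.
  rewrite mulrAC mulrC; apply: ler_wpM2l; first by rewrite exprn_ge0 ?ltW.
  by apply: le_trans H; rewrite lerDr.
apply: (@squeeze_cvgr _ _ _ _ (cst 0) (fun n => (y^-1 - 1)^-1 * y ^+ n)).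
- by apply: nearW => n; rewrite bnd andbT mulr_ge0// exprn_ge0.
- exact: cvg_cst.
- by apply: cvg_geometric; rewrite ger0_norm// ltW.
Qed.

(** A polynomial approximation of the indicator of [t < 1/2] on the unit
interval.  The exponent is large compared with [2^N], so that the value at
[1/2] itself tends to [0], and small enough for [N (2 t)^N] to tend to [0]
when [t < 1/2]. *)
Definition step_poly (R : realType) (N : nat) (t : R) : R :=
  (1 - t ^+ N) ^+ (N * 2 ^ N).

(** Below [1/2] Bernoulli's inequality gives the lower bound
[1 - N (2 t)^N]; from [1/2] on, [(1 - a)(1 + a) <= 1] and Bernoulli's inequality
for [1 + t^N] give the upper bound [1 / (N + 1)]. *)
Lemma step_poly_cvg (R : realType) (t : R) : 0 <= t <= 1 ->
  step_poly N t @[N --> \oo] --> ((t < 2^-1)%R%:R : R).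
Proof.
move=> /andP[t0 t1]; have tN1 N : t ^+ N <= 1 by rewrite exprn_ile1.
have tN0 N : 0 <= t ^+ N by rewrite exprn_ge0.
have [th|th] := ltP t 2^-1.
- have -> : (true%:R : R) = 1 - 0 by rewrite subr0.
  apply: (@squeeze_cvgr _ _ _ _ (fun N => 1 - N%:R * (2 * t) ^+ N) (cst 1)).
  + apply: nearW => N; rewrite /step_poly; apply/andP; split.
      have /(bernoulli_ineq (N * 2 ^ N)) : -1 <= - t ^+ N by rewrite lerN2.
      by rewrite mulrN natrM natrX exprMn mulrA.
    by rewrite exprn_ile1 ?subr_ge0// lerBlDr lerDl.
  + apply: cvgB; first exact: cvg_cst.
    by apply: cvg_natM_expr; lra.
  + by rewrite subr0; exact: cvg_cst.
- apply: (@squeeze_cvgr _ _ _ _ (cst 0) (@harmonic R)).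
  + apply: nearW => N; rewrite /step_poly exprn_ge0 ?subr_ge0//=.
    rewrite -[leRHS]mul1r ler_pdivlMr ?ltr0n//.
    have /(bernoulli_ineq (N * 2 ^ N)) H : -1 <= t ^+ N.
      by apply: le_trans (tN0 N); lra.
    have H1 : N.+1%:R <= (1 + t ^+ N) ^+ (N * 2 ^ N).
      apply: le_trans H; rewrite -natr1 addrC lerD2l natrM natrX -mulrA -exprMn.
      by rewrite ler_peMr// exprn_ege1//; lra.
    apply: (le_trans (ler_wpM2l _ H1)); first by rewrite exprn_ge0 ?subr_ge0.
    rewrite -exprMn exprn_ile1//; have := tN0 N; have := tN1 N; nra.
  + exact: cvg_cst.
  + exact: cvg_harmonic.
Qed.

(** A trigonometric function of [s] with values in the unit interval.  The slow
frequency makes it increasing through [1/2] at [s = b] on a window around [b]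
that grows with [k]. *)
Definition sin_ramp (R : realType) (b : R) (k : nat) (s : R) : R :=
  (1 + sin ((s - b) / k.+1%:R)) / 2.

Lemma sin_ramp_itv (R : realType) (b : R) k s : 0 <= sin_ramp b k s <= 1.
Proof.
rewrite /sin_ramp; have := sin_geN1 ((s - b) / k.+1%:R).
have := sin_le1 ((s - b) / k.+1%:R); move=> h1 h2.
apply/andP; split; lra.
Qed.

Lemma sin_ramp_cvg (R : realType) (b s : R) :
  (((sin_ramp b k s < 2^-1)%R%:R : R) @[k --> \oo]) --> ((s < b)%R%:R : R).
Proof.
apply: cvg_near_cst.
near=> k.
have k0 : (0 : R) < k.+1%:R by rewrite ltr0n.
have hk : `|s - b| < k.+1%:R.
  near: k; exists (Num.bound `|s - b|) => //= k /= hk.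
  apply: (lt_le_trans (archi_boundP _)) => //.
  by rewrite ler_nat (leq_trans hk).
have hsk : `|(s - b) / k.+1%:R| < 1.
  by rewrite normrM normfV (ger0_norm (ltW k0)) ltr_pdivrMr// mul1r.
congr (_%:R); congr nat_of_bool.
have -> : (sin_ramp b k s < 2^-1) = (sin ((s - b) / k.+1%:R) < 0).
  by rewrite /sin_ramp; apply/idP/idP; lra.
have <- : ((s - b) / k.+1%:R < 0) = (s < b).
  by rewrite pmulr_llt0 ?invr_gt0// subr_lt0.
move: hsk; move: (_ / k.+1%:R) => u.
rewrite ltr_norml => /andP[h1 h2]; have pi2 := @pihalf_ge1 R.
rewrite -[X in _ < X](@sin0 R) ltr_sin// in_itv/=.
- by rewrite (le_trans _ (ltW h1)) ?lerN2//= (le_trans (ltW h2)).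
- by rewrite oppr_le0 (le_trans ler01 pi2).
Unshelve. all: by end_near.
Qed.

Lemma cvg_bigprod (R : realType) (I : Type) (r : seq I) (h : nat -> I -> R)
    (l : I -> R) : (forall i, h n i @[n --> \oo] --> l i) ->
  \prod_(i <- r) h n i @[n --> \oo] --> \prod_(i <- r) l i.
Proof.
move=> hl; elim: r => [|i r ih].
  by rewrite big_nil; under eq_fun do rewrite big_nil; exact: cvg_cst.
rewrite big_cons; under eq_fun do rewrite big_cons.
by apply: cvgM => //; exact: hl.
Qed.

(** The phase [th] makes cosines enough to span the trigonometric polynomials,
and each generator is a function of the single linear form [u . x]. *)
Inductive trig_poly (R : realType) (d : nat) : (d.-tuple R -> R) -> Prop :=
| trig_cos u th : trig_poly (fun x => cos (dotv u (colvec x) + th))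
| trig_add f g : trig_poly f -> trig_poly g -> trig_poly (fun x => f x + g x)
| trig_scale c f : trig_poly f -> trig_poly (fun x => c * f x).

Lemma measurable_cos (R : realType) : measurable_fun [set: R] (@cos R).
Proof. by apply: continuous_measurable_fun; exact: continuous_cos. Qed.

Section trig_algebra.
Context {R : realType} {d : nat}.
Implicit Types f g : d.-tuple R -> R.

Lemma trig_cst c : trig_poly (fun _ : d.-tuple R => c).
Proof.
have := trig_scale c (@trig_cos R d 0 0); congr trig_poly.
by apply/funext => x; rewrite /dotv trmx0 mul0mx mxE addr0 cos0 mulr1.
Qed.

(** This is where products become sums:
[2 cos a cos b = cos (a + b) + cos (a - b)]. *)
Lemma trig_mul f g : trig_poly f -> trig_poly g -> trig_poly (fun x => f x * g x).
Proof.
move=> tf tg; elim: tf => {f}.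
- move=> u th; elim: tg => {g}.
  + move=> v ph.
    have := trig_scale 2^-1 (trig_add (trig_cos (u + v) (th + ph))
                               (trig_cos (u + (-1) *: v) (th - ph))).
    congr trig_poly; apply/funext => x.
    rewrite !dotvDl dotvZl.
    set a := dotv u _; set b := dotv v _.
    have -> : a + b + (th + ph) = (a + th) + (b + ph) by ring.
    have -> : a + -1 * b + (th - ph) = (a + th) - (b + ph) by ring.
    by rewrite cosD cosB; field.
  + move=> f g _ tf _ tg; have := trig_add tf tg; congr trig_poly.
    by apply/funext => x; rewrite mulrDr.
  + move=> c f _ tf; have := trig_scale c tf; congr trig_poly.
    by apply/funext => x; rewrite mulrCA.
- move=> f h _ tf _ th; have := trig_add tf th; congr trig_poly.
  by apply/funext => x; rewrite mulrDl.
- move=> c f _ tf; have := trig_scale c tf; congr trig_poly.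
  by apply/funext => x; rewrite mulrA.
Qed.

Lemma trig_exp f n : trig_poly f -> trig_poly (fun x => f x ^+ n).
Proof.
move=> tf; elim: n => [|n ih].
  by have := trig_cst 1; congr trig_poly; apply/funext => x; rewrite expr0.
by have := trig_mul tf ih; congr trig_poly; apply/funext => x; rewrite exprS.
Qed.

Lemma trig_prod (I : Type) (r : seq I) (f : I -> d.-tuple R -> R) :
  (forall i, trig_poly (f i)) -> trig_poly (fun x => \prod_(i <- r) f i x).
Proof.
move=> tf; elim: r => [|i r ih].
  by have := trig_cst 1; congr trig_poly; apply/funext => x; rewrite big_nil.
have := trig_mul (tf i) ih; congr trig_poly.
by apply/funext => x; rewrite big_cons.
Qed.

(** A sine is a cosine shifted by a quarter of a period. *)
Lemma trig_step N k (b : R) (i : 'I_d) :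
  trig_poly (fun x => step_poly N (sin_ramp b k (tnth x i))).
Proof.
apply: trig_exp.
have tr : trig_poly (fun x => sin_ramp b k (tnth x i)).
  have := trig_scale 2^-1 (trig_add (trig_cst 1)
    (trig_cos (k.+1%:R^-1 *: delta_mx i ord0) (- (b / k.+1%:R) - pi / 2))).
  congr trig_poly; apply/funext => x.
  rewrite /sin_ramp dotvZl dotv_delta_colvec addrA cosBpihalf mulrC; congr ((1 + sin _) / _).
  by rewrite mulrBl mulrC.
have := trig_add (trig_cst 1) (trig_scale (-1) (trig_exp N tr)).
by congr trig_poly; apply/funext => x; rewrite mulN1r.
Qed.

Lemma trig_measurable f : trig_poly f -> measurable_fun setT f.
Proof.
elim=> [u th|{}f g _ mf _ mg|c {}f _ mf].
- apply: (measurableT_comp (@measurable_cos R)).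
  by apply: measurable_funD => //; exact: measurable_dotv.
- exact: measurable_funD.
- exact: measurable_funM.
Qed.

Lemma trig_bounded f : trig_poly f -> exists M, forall x, `|f x| <= M.
Proof.
elim=> [u th|{}f g _ [M hM] _ [N hN]|c {}f _ [M hM]].
- by exists 1 => x; exact: cos_max.
- exists (M + N) => x; apply: le_trans (ler_normD _ _) _; exact: lerD.
- by exists (`|c| * M) => x; rewrite normrM ler_wpM2l.
Qed.

End trig_algebra.

Section integral_agreement.
Context {R : realType} {d : measure_display} {T : measurableType d}.
Variables mu nu : probability T R.

(** The uniform bound makes this class stable under pointwise limits, by
dominated convergence. *)
Definition same_mean (f : T -> R) : Prop :=
  [/\ measurable_fun setT f, (forall x, `|f x| <= 1) &
      (\int[mu]_x (f x)%:E = \int[nu]_x (f x)%:E)%E].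

Lemma cvg_mean (P : probability T R) (h : nat -> T -> R) (f : T -> R) :
  (forall n, measurable_fun setT (h n)) -> (forall n x, `|h n x| <= 1) ->
  (forall x, h n x @[n --> \oo] --> f x) ->
  ((\int[P]_x (h n x)%:E)%E @[n --> \oo] --> (\int[P]_x (f x)%:E)%E).
Proof.
move=> mh h1 hf.
have mf : measurable_fun setT f by apply: (measurable_fun_cvg mh) => x _; exact: hf.
have [] := @dominated_convergence _ _ _ P _ measurableT
  (fun n x => (h n x)%:E) (EFin \o f) (cst 1%E).
- by move=> n; exact/measurable_EFinP.
- exact/measurable_EFinP.
- by apply: aeW => x _; apply: cvg_EFin; [exact: nearW|exact: hf].
- by apply: finite_measure_integrable_cst.
- by apply: aeW => x n _; rewrite /= lee_fin.
by move=> _ _.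
Qed.

Lemma same_mean_cvg (h : nat -> T -> R) (f : T -> R) :
  (forall n, same_mean (h n)) -> (forall x, h n x @[n --> \oo] --> f x) ->
  same_mean f.
Proof.
move=> sh hf.
have mh n : measurable_fun setT (h n) by have [] := sh n.
have h1 n x : `|h n x| <= 1 by have [_ + _] := sh n; apply.
split.
- by apply: (measurable_fun_cvg mh) => x _; exact: hf.
- move=> x; apply: (@ler_cvg_to _ \oo _ _ (fun n => `|h n x|) (cst 1)).
  + exact: (cvg_norm (hf x)).
  + exact: cvg_cst.
  + exact: nearW.
- have c1 := @cvg_mean mu h f mh h1 hf.
  have c2 := @cvg_mean nu h f mh h1 hf.
  apply: (cvg_unique _ c1) => //.
  rewrite (_ : (fun n => _) = fun n => (\int[nu]_x (h n x)%:E)%E)//.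
  by apply/funext => n; have [_ _] := sh n.
Qed.

End integral_agreement.

Definition quadrant (R : realType) (d : nat) (b : 'I_d -> R) :
    set (d.-tuple R) :=
  [set x | forall i, tnth x i < b i].

Section cramer_wold.
Context {R : realType} {d : nat}.
Variables mu nu : probability (d.-tuple R) R.
Hypothesis same_law : forall (u : 'cV[R]_d) (A : set R), measurable A ->
  mu [set x | A (dotv u (colvec x))] = nu [set x | A (dotv u (colvec x))].

Lemma trig_poly_mean f : trig_poly f ->
  (\int[mu]_x (f x)%:E = \int[nu]_x (f x)%:E)%E.
Proof.
move=> tf.
have ig (P : probability (d.-tuple R) R) g : trig_poly g ->
    P.-integrable setT (EFin \o g).
  move=> tg; have [M hM] := trig_bounded tg.
  apply: measurable_bounded_integrable => //.
  - by rewrite (le_lt_trans (probability_le1 _ _))// ltry.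
  - exact: trig_measurable.
  - by exists M; split; [exact: num_real|move=> y /ltW My x _; exact: le_trans My].
elim: tf => {f}.
- move=> u th.
  pose g (y : R) := (cos (y + th))%:E.
  have mg : measurable_fun setT g.
    apply/measurable_EFinP; apply: (measurableT_comp (@measurable_cos R)).
    exact: measurable_funD.
  have push (P : probability (d.-tuple R) R) :
      (\int[P]_x (cos (dotv u (colvec x) + th))%:E =
       \int[image_law P (measurable_dotv u)]_y g y)%E.
    by rewrite integral_image_law//; exact: (ig P _ (trig_cos u th)).
  rewrite !push; apply: eq_measure_integral => A mA _.
  exact: same_law.
- move=> f g tf ihf tg ihg.
  under eq_integral do rewrite EFinD.
  under [RHS]eq_integral do rewrite EFinD.
  by rewrite !integralD//= ?ihf ?ihg//; exact: ig.
- move=> c f tf ihf.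
  under eq_integral do rewrite EFinM.
  under [RHS]eq_integral do rewrite EFinM.
  by rewrite !integralZl//= ?ihf//; exact: ig.
Qed.

(** Two limits are taken in turn: first in the degree [N], which turns each
ramp into the indicator of [ramp < 1/2], then in the period [k], which turns the
latter into the indicator of [x_i < b_i]. *)
Lemma same_mean_quadrant (b : 'I_d -> R) :
  same_mean mu nu (fun x => \prod_i ((tnth x i < b i)%R%:R : R)).
Proof.
apply: (@same_mean_cvg _ _ _ _ _ (fun k x =>
    \prod_i ((sin_ramp (b i) k (tnth x i) < 2^-1)%R%:R : R))); last first.
  by move=> x; apply: cvg_bigprod => i; exact: sin_ramp_cvg.
move=> k; apply: (@same_mean_cvg _ _ _ _ _ (fun N x =>
    \prod_i step_poly N (sin_ramp (b i) k (tnth x i)))); last first.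
  by move=> x; apply: cvg_bigprod => i; apply: step_poly_cvg; exact: sin_ramp_itv.
move=> N.
have tp : trig_poly (fun x => \prod_i step_poly N (sin_ramp (b i) k (tnth x i))).
  by apply: trig_prod => i; exact: trig_step.
split; [exact: trig_measurable| |exact: trig_poly_mean].
move=> x; rewrite normr_prod; apply: prodr_ile1 => i _; rewrite normr_ge0/=.
have /andP[t0 t1] := sin_ramp_itv (b i) k (tnth x i).
rewrite /step_poly normrX exprn_ile1// ger0_norm ?subr_ge0 ?exprn_ile1//.
by rewrite lerBlDr lerDl exprn_ge0.
Qed.

Lemma measurable_quadrant (b : 'I_d -> R) : measurable (quadrant b).
Proof.
rewrite (_ : quadrant b = \bigcap_(i in [set: 'I_d]) ((fun x => tnth x i) @^-1` `]-oo, b i[)).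
  apply: fin_bigcap_measurable => // i _.
  by rewrite -[X in measurable X]setTI; exact: measurable_tnth.
by apply/seteqP; split => [x xb i _|x xb i] /=; have := xb i; rewrite ?in_itv//=; apply.
Qed.

Lemma quadrant_measure (b : 'I_d -> R) : mu (quadrant b) = nu (quadrant b).
Proof.
have [_ _] := same_mean_quadrant b.
have E x : \prod_i ((tnth x i < b i)%R%:R : R) = \1_(quadrant b) x.
  rewrite indicE; have [xb|xb] := boolP (x \in quadrant b).
    by rewrite big1// => i _; rewrite (set_mem xb i).
  have [i /negP xi] : exists i, ~ tnth x i < b i.
    by apply/existsNP => H; move/negP: xb; apply; exact/mem_set.
  by rewrite (bigD1 i)//= (negbTE xi) mul0r.
under eq_integral do rewrite E.
under [in RHS]eq_integral do rewrite E.
by rewrite !integral_indic ?setIT//; exact: measurable_quadrant.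
Qed.

Lemma quadrantI (b c : 'I_d -> R) :
  quadrant b `&` quadrant c = quadrant (fun i => Num.min (b i) (c i)).
Proof.
apply/seteqP; split => x /=.
  by move=> [xb xc] i; rewrite lt_min xb xc.
by move=> xbc; split => i; have := xbc i; rewrite lt_min => /andP[].
Qed.

Lemma quadrants_cover : \bigcup_k quadrant (fun _ : 'I_d => k%:R : R) = setT.
Proof.
rewrite -subTset => x _.
exists (\max_i Num.bound `|tnth x i|)%N => // i /=.
apply: (le_lt_trans (ler_norm _)); apply: (lt_le_trans (archi_boundP _)) => //.
by rewrite ler_nat; exact: (leq_bigmax i).
Qed.

(** A half-space [x_i < b] is the increasing union of the quadrants whose
other bounds go to infinity. *)
Lemma measurable_tnth_quadrant (i : 'I_d) :
  @measurable_fun _ _ (g_sigma_algebraType (range (@quadrant R d))) _ setT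
    (fun x : d.-tuple R => tnth x i).
Proof.
apply: (measurability _ (RGenInftyO.measurableE R)) => _ [_ [b ->] <-].
rewrite setTI.
have -> : (fun x : d.-tuple R => tnth x i) @^-1` `]-oo, b[ =
    \bigcup_k quadrant (fun j => if j == i then b else k%:R).
  apply/seteqP; split => x /=; rewrite in_itv/=.
    move=> xb; exists (\max_j Num.bound `|tnth x j|)%N => // j /=.
    have [->//|_] := eqVneq j i.
    apply: (le_lt_trans (ler_norm _)); apply: (lt_le_trans (archi_boundP _)) => //.
    by rewrite ler_nat; exact: (leq_bigmax j).
  by move=> [k _ /(_ i)]; rewrite eqxx.
apply: bigcupT_measurable => k; apply: sub_sigma_algebra.
by exists (fun j => if j == i then b else k%:R).
Qed.

(** Quadrants are stable under intersection, cover the space and generate its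
Borel sets, so that two finite measures that agree on them are equal. *)
Lemma cramer_wold A : measurable A -> mu A = nu A.
Proof.
apply: (measure_unique (range (@quadrant R d)) (fun k => quadrant (fun=> k%:R))).
- apply/seteqP; split; last first.
    apply: smallest_sub; first exact: sigma_algebra_measurable.
    by move=> _ [b _ <-]; exact: measurable_quadrant.
  apply: smallest_sub; first exact: smallest_sigma_algebra.
  rewrite -bigcup_seq => S [i _ [B mB <-]].
  exact: measurable_tnth_quadrant.
- by move=> _ _ [b _ <-] [c _ <-]; rewrite quadrantI; exists (fun i => Num.min (b i) (c i)).
- by move=> k; exists (fun=> k%:R).
- exact: quadrants_cover.
- by move=> _ [b _ <-]; exact: quadrant_measure.
- by move=> k; rewrite (le_lt_trans (probability_le1 _ _)) ?ltry//; exact: measurable_quadrant.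
Qed.

End cramer_wold.

(** * Measures with a density *)

Section density.
Context {d : measure_display} {T : measurableType d} {R : realType}.
Variables (mu nu : {measure set T -> \bar R}) (g : T -> R).
Hypotheses (mg : measurable_fun setT g) (g0 : forall x, 0 <= g x).
Hypothesis nuE : forall A, measurable A ->
  nu A = (\int[mu]_(x in A) (g x)%:E)%E.
Local Open Scope ereal_scope.
Import HBNNSimple.

Let sintegral_density (h : {nnsfun T >-> R}) :
  \int[nu]_x (h x)%:E = \int[mu]_x ((h x)%:E * (g x)%:E).
Proof.
transitivity (\int[nu]_x
   (\sum_(y \in range h) (y * \1_(h @^-1` [set y]) x)%:E)).
  by apply: eq_integral => t _; rewrite fimfunE -fsumEFin.
rewrite ge0_integral_fsum//; last 2 first.
- by move=> r; apply/measurable_EFinP; exact: measurable_funM.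
- by move=> m y _; exact: nnfun_muleindic_ge0.
transitivity (\int[mu]_x (\sum_(y \in range h)
    ((y * \1_(h @^-1` [set y]) x)%:E * (g x)%:E))); last first.
  apply: eq_integral => x _.
  rewrite -ge0_mule_fsuml => [|y]; last exact: nnfun_muleindic_ge0.
  by rewrite fsumEFin // -(fimfunE _ x).
rewrite ge0_integral_fsum//; last 2 first.
- move=> y; apply: emeasurable_funM; apply/measurable_EFinP => //.
  exact: measurable_funM.
- move=> m y _; apply: mule_ge0; last by rewrite lee_fin.
  exact: nnfun_muleindic_ge0.
apply: eq_fsbigr => r; rewrite inE => -[t _ <-].
rewrite integralZl_indic_nnsfun//.
under [RHS]eq_integral do rewrite EFinM -muleA.
rewrite ge0_integralZl//; last 3 first.
- by apply: emeasurable_funM; exact/measurable_EFinP.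
- by move=> x _; rewrite mule_ge0 ?lee_fin.
- by rewrite lee_fin.
congr (_ * _); rewrite integral_indic// setIT nuE// integral_mkcond.
by apply: eq_integral => x _; rewrite epatch_indic/= muleC.
Qed.

(** Both sides are additive and continuous along increasing sequences, so that
the hypothesis, which is the case of indicators, extends to simple functions and
then to nonnegative measurable functions. *)
Lemma ge0_integral_density (f : T -> \bar R) :
  measurable_fun setT f -> (forall x, 0 <= f x) ->
  \int[nu]_x f x = \int[mu]_x (f x * (g x)%:E).
Proof.
move=> mf f0; pose h := nnsfun_approx measurableT mf.
have hcvg x : (EFin \o h ^~ x) n @[n --> \oo] --> f x.
  by apply: cvg_nnsfun_approx => //; move=> y _; exact: f0.
transitivity (limn (fun n => \int[nu]_x (h n x)%:E)).
  rewrite -monotone_convergence//.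
  - by apply: eq_integral => x _; apply/esym/cvg_lim => //; exact: hcvg.
  - by move=> n; apply/measurable_EFinP.
  - by move=> n x _; rewrite lee_fin.
  - by move=> x _ a b ab; rewrite lee_fin; exact/lefP/nd_nnsfun_approx.
under eq_fun do rewrite sintegral_density.
rewrite -monotone_convergence//.
- apply: eq_integral => x _; apply/cvg_lim => //.
  by apply: cvgeZr => //; exact: hcvg.
- by move=> n; apply: emeasurable_funM; exact/measurable_EFinP.
- by move=> n x _; rewrite mule_ge0 ?lee_fin.
- move=> x _ a b ab; rewrite lee_wpmul2r ?lee_fin//.
  exact/lefP/nd_nnsfun_approx.
Qed.

End density.

(** * Affine changes of variable *)

Lemma measurable_affine (R : realType) (a s : R) :
  measurable_fun [set: R] (fun x => a + s * x).
Proof. by apply: measurable_funD => //; exact: measurable_funM. Qed.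

Section lebesgue_affine.
Context {R : realType}.
Variables a s : R.
Hypothesis s0 : s != 0.
Local Notation leb := (@lebesgue_measure R).

Let aff (x : measurableTypeR R) : measurableTypeR R := a + s * x.

Let maff : measurable_fun [set: measurableTypeR R] aff.
Proof. exact: measurable_affine. Qed.

Let image_leb : {measure set (measurableTypeR R) -> \bar R}.
Proof. by unshelve refine (pushforward leb aff); exact: maff. Defined.

Let nu : {measure set (measurableTypeR R) -> \bar R} :=
  mscale (NngNum (normr_ge0 s)) image_leb.

(** Both sides are measures of [A], and they agree on half-open intervals; the
preimage of such an interval is open on the other side when [s < 0]. *)
Lemma lebesgue_measure_affine A : measurable A ->
  (leb A = `|s|%:E * leb [set x | A (a + s * x)%R])%E.
Proof.
move=> mA.
have : leb A = nu A; last by [].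
apply: lebesgue_measure_unique mA => _ [[u v] _ <-] /=.
rewrite /nu /mscale/= /pushforward/=.
have [sp|sn] : s > 0 \/ s < 0.
- by move: s0; rewrite neq_lt => /orP[]; [right|left].
- have -> : aff @^-1` `]u, v] = `](u - a) / s, (v - a) / s]%classic.
    apply/seteqP; split => x /=;
      rewrite !in_itv/= /aff ltr_pdivrMr// ler_pdivlMr// ltrBlDl lerBrDl (mulrC _ s)//.
  rewrite !lebesgue_measure_itv/= !lte_fin ltr_pM2r ?invr_gt0// ltrD2r.
  case: ifP => _; last by rewrite mule0.
  by rewrite -!EFinD -EFinM gtr0_norm//; congr EFin; field.
- have -> : aff @^-1` `]u, v] = `[(v - a) / s, (u - a) / s[%classic.
    apply/seteqP; split => x /=;
      rewrite !in_itv/= /aff ltr_ndivlMr// ler_ndivrMr// ltrBlDl lerBrDl (mulrC _ s) andbC//.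
  rewrite !lebesgue_measure_itv/= !lte_fin ltr_nM2r ?invr_lt0// ltrD2r.
  case: ifP => _; last by rewrite mule0.
  by rewrite -!EFinD -EFinM ltr0_norm//; congr EFin; field.
Qed.

Lemma ge0_integral_affine (h : R -> \bar R) :
  measurable_fun setT h -> (forall x, (0 <= h x)%E) ->
  (\int[leb]_x h x = `|s|%:E * \int[leb]_x h (a + s * x)%R)%E.
Proof.
move=> mh h0.
rewrite (eq_measure_integral nu); last first.
  by move=> A mA _; exact: lebesgue_measure_affine.
by rewrite ge0_integral_mscale//= ge0_integral_pushforward.
Qed.

End lebesgue_affine.

(** * Normal laws on the line *)

Section normal_laws.
Context {R : realType}.
Local Notation leb := (@lebesgue_measure R).

Definition stdN : probability (measurableTypeR R) R := normal_prob (0 : R) 1.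

Lemma ge0_integral_normal (a s : R) (f : R -> \bar R) :
  measurable_fun setT f -> (forall x, (0 <= f x)%E) ->
  (\int[normal_prob a s]_x f x = \int[leb]_x (f x * (normal_pdf a s x)%:E))%E.
Proof.
move=> mf f0; apply: ge0_integral_density => //.
- exact: measurable_normal_pdf.
- exact: normal_pdf_ge0.
Qed.

Lemma normal_peakE (s : R) : normal_peak s = `|s|^-1 * normal_peak 1.
Proof.
rewrite /normal_peak -invfM expr1n mul1r -mulrnAr sqrtrM ?sqr_ge0//.
by rewrite sqrtr_sqr.
Qed.

Lemma normal_pdf_affine (a s x : R) : s != 0 ->
  normal_pdf 0 1 x = `|s| * normal_pdf a s (a + s * x).
Proof.
move=> s0; rewrite !normal_pdfE ?oner_eq0// [in RHS]normal_peakE.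
rewrite !mulrA mulfV ?normr_eq0// mul1r; congr (_ * expR _).
by rewrite subr0; field.
Qed.

Lemma normal_prob_affine (a s : R) A : s != 0 -> measurable A ->
  normal_prob a s A = stdN [set x | A (a + s * x)].
Proof.
move=> s0 mA; rewrite /stdN /normal_prob /= integral_mkcond.
rewrite (ge0_integral_affine a s0)/=; last 2 first.
- apply/(measurable_restrictT _ _).1 => //.
  by apply/measurable_EFinP/measurable_funTS; exact: measurable_normal_pdf.
- by move=> x; apply: erestrict_ge0 => y _; rewrite lee_fin normal_pdf_ge0.
rewrite [RHS]integral_mkcond -ge0_integralZl//; last 2 first.
- have mh : measurable_fun setT ((fun x => (normal_pdf a s x)%:E) \_ A).
    apply/(measurable_restrictT _ _).1 => //.
    by apply/measurable_EFinP/measurable_funTS; exact: measurable_normal_pdf.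
  apply: (measurableT_comp mh); exact: measurable_affine.
- by move=> x _; apply: erestrict_ge0 => y _; rewrite lee_fin normal_pdf_ge0.
apply: eq_integral => x _; rewrite /= !patchE.
rewrite (_ : (a + s * x \in A) = (x \in [set x | A (a + s * x)])); last first.
  by apply/idP/idP => /set_mem H; exact/mem_set.
by case: ifPn => _; rewrite ?mule0// -EFinM -normal_pdf_affine.
Qed.

(** Completion of the square in [x]: the joint density of [(G, p G + q G')] at
[(x, y)] is the density of the second variable times the conditional density of
the first one given the second, both of them normal. *)
Lemma normal_pdf_conv (p q x y : R) : q != 0 ->
  let r := Num.sqrt (p ^+ 2 + q ^+ 2) in
  normal_pdf 0 1 x * normal_pdf (p * x) q y =
  normal_pdf 0 r y * normal_pdf (p * y / r ^+ 2) (q / r) x.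
Proof.
move=> q0 r.
have r2 : r ^+ 2 = p ^+ 2 + q ^+ 2 by rewrite sqr_sqrtr// addr_ge0 ?sqr_ge0.
have r0 : r != 0.
  by rewrite -sqrf_eq0 r2 gt_eqF// ltr_wpDl ?sqr_ge0// exprn_even_gt0.
rewrite !normal_pdfE ?oner_eq0 ?mulf_neq0 ?invr_neq0//.
rewrite mulrACA [RHS]mulrACA -!expRD; congr (_ * expR _).
- rewrite (normal_peakE q) (normal_peakE r) (normal_peakE (q / r)).
  by rewrite normrM normfV; field; rewrite !normr_eq0 r0 q0.
- rewrite expr_div_n r2.
  have : p ^+ 2 + q ^+ 2 != 0 by rewrite -r2 sqrf_eq0.
  by move=> h; field; rewrite q0 h.
Qed.

Lemma normal_pdf_norm (a s : R) : normal_pdf a `|s| = normal_pdf a s.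
Proof.
apply/funext => x; rewrite /normal_pdf normr_eq0; case: ifP => // _.
by rewrite /normal_peak /normal_fun -normrX ger0_norm ?sqr_ge0.
Qed.

Lemma stdN_norm (p : R) A : measurable A ->
  stdN [set t | A (`|p| * t)] = stdN [set t | A (p * t)].
Proof.
move=> mA; have [->|p0] := eqVneq p 0; first by rewrite normr0.
have h q : q != 0 -> stdN [set t | A (q * t)] = normal_prob 0 q A.
  move=> q0; rewrite normal_prob_affine//; congr (stdN _).
  by apply/funext => t /=; rewrite add0r.
by rewrite !h ?normr_eq0// /normal_prob normal_pdf_norm.
Qed.

Lemma measurable_normal_pdf2 (p q : R) : q != 0 ->
  measurable_fun setT (fun z : R * R => normal_pdf (p * z.1) q z.2).
Proof.
move=> q0.
rewrite (_ : (fun z => _) = normal_pdf 0 q \o (fun z : R * R => z.2 - p * z.1)).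
  apply: measurableT_comp; first exact: measurable_normal_pdf.
  by apply: measurable_funB => //; apply: measurable_funM.
apply/funext => z /=; rewrite !normal_pdfE// /normal_fun; congr (_ * expR _).
by rewrite subr0.
Qed.

(** If [G] and [G'] are independent standard normal variables, [p G + q G'] has
the law of [sqrt (p^2 + q^2) G].  By [normal_pdf_conv] and Tonelli's theorem the
first variable integrates out to [1].  The case [q = 0] has no density and only
uses the symmetry of the normal law. *)
Lemma stdN_conv (p q : R) A : measurable A ->
  (\int[stdN]_x stdN [set y | A (p * x + q * y)%R] =
   stdN [set t | A (Num.sqrt (p ^+ 2 + q ^+ 2) * t)%R])%E.
Proof.
move=> mA; have [->|q0] := eqVneq q 0.
  rewrite expr0n addr0 sqrtr_sqr stdN_norm//.
  transitivity (\int[stdN]_x (\1_[set x | A (p * x)] x)%:E)%E.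
    apply: eq_integral.
    move=> x _; rewrite indicE.
    have [xA|xA] := boolP (x \in _).
      rewrite (_ : [set y | _] = setT) ?probability_setT//.
      apply/seteqP; split => // y _ /=; rewrite mul0r addr0; exact: (set_mem xA).
    rewrite (_ : [set y | _] = set0) ?measure0//.
    apply/seteqP; split => // y /=; rewrite mul0r addr0 => Ax.
    by move/negP: xA; apply; exact/mem_set.
  rewrite integral_indic// ?setIT//.
  rewrite -[X in measurable X]setTI.
  have := @measurable_affine R 0 p measurableT A mA.
  by under eq_fun do rewrite add0r.
set r := Num.sqrt _.
have r2 : r ^+ 2 = p ^+ 2 + q ^+ 2 by rewrite sqr_sqrtr// addr_ge0 ?sqr_ge0.
have r0 : r != 0.
  by rewrite -sqrf_eq0 r2 gt_eqF// ltr_wpDl ?sqr_ge0// exprn_even_gt0.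
pose F (z : R * R) : \bar R :=
  (normal_pdf 0 1 z.1 * normal_pdf (p * z.1) q z.2 * \1_A z.2)%:E.
have mF : measurable_fun setT F.
  apply/measurable_EFinP; apply: measurable_funM.
    apply: measurable_funM.
      by apply: measurableT_comp => //; exact: measurable_normal_pdf.
    exact: (measurable_normal_pdf2 p q0).
  exact: measurableT_comp.
have F0 z : (0 <= F z)%E by rewrite lee_fin !mulr_ge0 ?normal_pdf_ge0.
have inner x : (stdN [set y | A (p * x + q * y)%R] * (normal_pdf 0 1 x)%:E
    = \int[leb]_y F (x, y))%E.
  rewrite -normal_prob_affine// /normal_prob muleC integral_mkcond.
  rewrite -ge0_integralZl//; last 3 first.
  - apply/(measurable_restrictT _ _).1 => //.
    by apply/measurable_EFinP/measurable_funTS; exact: measurable_normal_pdf.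
  - by move=> y _; apply: erestrict_ge0 => z _; rewrite lee_fin normal_pdf_ge0.
  - by rewrite lee_fin normal_pdf_ge0.
  apply: eq_integral => y _; rewrite /F/= patchE indicE.
  by case: ifPn => _; rewrite ?mulr1 ?mulr0 ?mule0.
rewrite ge0_integral_normal//; last first.
  pose S := (fun z : R * R => p * z.1 + q * z.2) @^-1` A.
  have mS : measurable S.
    have mpq : measurable_fun setT (fun z : R * R => p * z.1 + q * z.2).
      by apply: measurable_funD; apply: measurable_funM.
    by rewrite -[S]setTI; exact: mpq.
  have := measurable_fun_xsection stdN mS; congr (measurable_fun _ _).
  apply/funext => x /=; congr (stdN _).
  by apply/seteqP; split => y /=; rewrite /xsection/= inE.
under eq_integral do rewrite inner.
rewrite (@fubini_tonelli _ _ (measurableTypeR R) (measurableTypeR R) R leb leb F mF F0).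
transitivity (normal_prob 0 r A); last first.
  rewrite normal_prob_affine//; congr (stdN _).
  by apply/funext => t /=; rewrite add0r.
rewrite /normal_prob [RHS]integral_mkcond; apply: eq_integral => y _.
rewrite /F /= patchE.
under eq_integral do rewrite normal_pdf_conv//.
rewrite indicE; case: ifPn => _; last first.
  by rewrite integral0_eq// => x _; rewrite mulr0.
under eq_integral do rewrite mulr1 EFinM.
rewrite ge0_integralZl//; last 3 first.
- by apply/measurable_EFinP; exact: measurable_normal_pdf.
- by move=> x _; rewrite lee_fin normal_pdf_ge0.
- by rewrite lee_fin normal_pdf_ge0.
by rewrite integral_normal_pdf mule1.
Qed.

End normal_laws.

(** * Gaussian vectors *)

Section std_gaussian.
Context {R : realType}.

(** Writing normal laws as images of the standard one treats the degenerate
case [v = 0] on the same footing as the others. *)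
Lemma normal1E (a v : R) A : 0 <= v -> measurable A ->
  normal1 a v A = stdN [set t | A (a + Num.sqrt v * t)].
Proof.
move=> v0 mA; rewrite /normal1; case: eqVneq => [->|vn0].
  rewrite sqrtr0 diracE; have [aA|aA] := boolP (a \in A).
    rewrite (_ : [set t | _] = setT) ?probability_setT//.
    by apply/seteqP; split => // t _ /=; rewrite mul0r addr0; exact: set_mem.
  rewrite (_ : [set t | _] = set0) ?measure0//.
  apply/seteqP; split => // t /=; rewrite mul0r addr0 => At.
  by move/negP: aA; apply; exact: mem_set.
by rewrite normal_prob_affine// gt_eqF// sqrtr_gt0 lt_neqAle eq_sym vn0.
Qed.

(** Equivalent to being Gaussian with mean [0] and identity covariance, but
phrased so that no variance has to be distinguished from [0]. *)
Definition std_gaussian d (gam : probability (d.-tuple R) R) : Prop :=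
  forall (u : 'cV[R]_d) (A : set R), measurable A ->
    gam [set x | A (dotv u (colvec x))] = stdN [set t | A (enorm u * t)].

Lemma dotv_cons d (u : 'cV[R]_d.+1) (x : R) (z : d.-tuple R) :
  dotv u (colvec [tuple of x :: z]) =
  u ord0 ord0 * x + dotv (\col_i u (lift ord0 i) ord0) (colvec z).
Proof.
rewrite /dotv !mxE big_ord_recl !mxE; congr (_ + _).
by apply: eq_bigr => i _; rewrite !mxE tnthS.
Qed.

Lemma dotv_recl d (u : 'cV[R]_d.+1) (w := \col_i u (lift ord0 i) ord0) :
  dotv u u = u ord0 ord0 ^+ 2 + dotv w w.
Proof.
rewrite /dotv !mxE big_ord_recl !mxE expr2; congr (_ + _).
by apply: eq_bigr => i _; rewrite !mxE.
Qed.

(** Induction on the dimension: the new coordinate is an independent standard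
normal variable, and [stdN_conv] adds its contribution to a linear form. *)
Lemma std_gaussian_exists d : exists gam, @std_gaussian d gam.
Proof.
elim: d => [|d [gam ih]].
  exists (dirac [tuple]) => u A mA.
  have u0 : u = 0 by apply/colP => -[].
  have e0 : enorm u = 0 by rewrite /enorm u0 /dotv mulmx0 mxE sqrtr0.
  have d0 x : dotv u (colvec x) = 0 by rewrite u0 /dotv trmx0 mul0mx mxE.
  change ((\1_[set x : 0.-tuple R | A (dotv u (colvec x))]
    ([tuple] : 0.-tuple R))%:E = stdN [set t | A (enorm u * t)]).
  rewrite indicE; have [A0|A0] := pselect (A 0).
    rewrite mem_set/= ?d0// (_ : [set t | _] = setT) ?probability_setT//.
    by apply/seteqP; split => // t _ /=; rewrite e0 mul0r.
  rewrite memNset/= ?d0// (_ : [set t | _] = set0) ?measure0//.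
  by apply/seteqP; split => // t /=; rewrite e0 mul0r.
have mcons : measurable_fun setT (fun z : R * d.-tuple R => [tuple of z.1 :: z.2]).
  exact: measurable_cons.
exists (image_law (stdN \x gam)%E mcons) => u A mA.
rewrite image_lawE /=.
set w := \col_i u (lift ord0 i) ord0.
transitivity (\int[stdN]_x stdN [set t | A (u ord0 ord0 * x + enorm w * t)%R])%E.
  apply: eq_integral => x _ /=.
  have mA' : measurable [set s | A (u ord0 ord0 * x + s)].
    have := @measurable_affine R (u ord0 ord0 * x) 1 measurableT A mA.
    by under eq_fun do rewrite mul1r; rewrite setTI.
  rewrite -(ih w _ mA'); congr (gam _).
  by apply/seteqP; split => z /=; rewrite /xsection/= inE/= dotv_cons.
rewrite stdN_conv//; congr (stdN _); apply/seteqP.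
by rewrite sqr_enorm -dotv_recl; split.
Qed.

(** A linear form of [a + B Z] is, up to a constant, the linear form of [Z] with
coefficients [B^T u], whose squared norm is [u^T B B^T u]. *)
Lemma std_gaussian_affine d e (gam : probability (d.-tuple R) R)
    (a : 'cV[R]_e) (B : 'M[R]_(e, d)) (P : set (e.-tuple R) -> \bar R)
    (f : d.-tuple R -> e.-tuple R) :
  std_gaussian gam -> (forall x, colvec (f x) = a + B *m colvec x) ->
  (forall A, measurable A -> P A = gam (f @^-1` A)) ->
  is_gaussian P a (B *m B^T).
Proof.
move=> sg fE PE.
have q u : dotv u (B *m B^T *m u) = dotv (B^T *m u) (B^T *m u).
  by rewrite /dotv trmx_mul trmxK !mulmxA.
split.
- by rewrite trmx_mul trmxK.
- by move=> u; rewrite q dotv_ge0.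
move=> u A mA.
rewrite PE; last first.
  by rewrite -[X in measurable X]setTI; exact: measurable_dotv.
rewrite normal1E ?q ?dotv_ge0//.
have mA' : measurable [set s | A (dotv u a + s)].
  have := @measurable_affine R (dotv u a) 1 measurableT A mA.
  by under eq_fun do rewrite mul1r; rewrite setTI.
rewrite -(sg (B^T *m u) _ mA'); congr (gam _).
have fd x : dotv u (colvec (f x)) = dotv u a + dotv (B^T *m u) (colvec x).
  by rewrite fE /dotv mulmxDr mxE trmx_mul trmxK -mulmxA.
by apply/seteqP; split => x /=; rewrite fd.
Qed.

Lemma gaussian_unique d (mu nu : probability (d.-tuple R) R) a S :
  is_gaussian mu a S -> is_gaussian nu a S ->
  forall A, measurable A -> mu A = nu A.
Proof.
move=> [_ _ gm] [_ _ gn]; apply: cramer_wold => u A mA.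
by rewrite gm// gn.
Qed.

End std_gaussian.

(** * The fourth moment of the normal law *)

Section fourth_moment.
Context {R : realType}.

Lemma expR_ge_quadratic (z : R) : 0 <= z -> 1 + z + z ^+ 2 / 2 <= expR z.
Proof.
move=> z0; have -> : 1 + z + z ^+ 2 / 2 = series (exp_coeff z) 3%N.
  rewrite /series/= !big_nat_recr//= big_geq// add0r /exp_coeff/=.
  by rewrite expr0 expr1 -[(0`!)%N]/1%N -[(1`!)%N]/1%N -[(2`!)%N]/2%N !divr1.
apply: nondecreasing_cvgn_le; last exact: is_cvg_series_exp_coeff.
by apply: nondecreasing_series => n _ _; exact: exp_coeff_ge0.
Qed.

(** [e^y + e^-y - 2] is the square of [e^z - e^-z] for [z = y / 2], and
[e^z - e^-z >= 2 z] follows from [e^z >= 1 + z + z^2 / 2]. *)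
Lemma cosh_ge (y : R) : 0 <= y -> 2 + y ^+ 2 <= expR y + expR (- y).
Proof.
move=> y0.
have z0 : 0 <= y / 2 by lra.
have h := expR_ge_quadratic z0.
rewrite (_ : y = 2%:R * (y / 2)); last by field.
rewrite -mulrN !expRM_natl expRN; move: h z0; set z := y / 2.
set E := expR z => h z0.
have E1 : 1 <= E by apply: le_trans h; have := sqr_ge0 z; nra.
have D : 2 * z <= E - E^-1.
  rewrite -(ler_pM2l (lt_le_trans ltr01 E1)) mulrBr mulfV ?gt_eqF ?(lt_le_trans ltr01)//.
  have z2 := sqr_ge0 z.
  have : 0 <= (E - (1 + z + z ^+ 2 / 2)) * (E + 1 + z ^+ 2 / 2 - z).
    by apply: mulr_ge0; nra.
  have : 0 <= z ^+ 4 by rewrite exprn_even_ge0.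
  nra.
have EE : E * E^-1 = 1 by rewrite mulfV// gt_eqF// (lt_le_trans ltr01).
have : (2 * z) ^+ 2 <= (E - E^-1) ^+ 2 by rewrite ler_sqr ?nnegrE; lra.
nra.
Qed.

(** Multiplying the standard density by this exponential gives [s] times the
density of variance [s^2]. *)
Lemma stdN_expR_sqr (s : R) : 0 < s ->
  (\int[@stdN R]_x (expR ((1 - s ^- 2) / 2 * x ^+ 2))%:E = s%:E)%E.
Proof.
move=> s0; have sn0 : s != 0 by rewrite gt_eqF.
rewrite ge0_integral_normal; last 2 first.
- apply/measurable_EFinP; apply: measurableT_comp; first exact: measurable_expR.
  by apply: measurable_funM => //; exact: measurable_funX.
- by move=> x; rewrite lee_fin expR_ge0.
transitivity (\int[lebesgue_measure]_x (s%:E * (normal_pdf 0 s x)%:E))%E.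
  apply: eq_integral => x _; rewrite -!EFinM; congr EFin.
  rewrite !normal_pdfE ?oner_eq0// [in RHS]normal_peakE gtr0_norm//.
  rewrite mulrCA -[in RHS]mulrA mulVKf// /normal_fun -expRD; congr (_ * expR _).
  by field.
rewrite ge0_integralZl//; last 3 first.
- by apply/measurable_EFinP; exact: measurable_normal_pdf.
- by move=> x _; rewrite lee_fin normal_pdf_ge0.
- by rewrite lee_fin ltW.
by rewrite integral_normal_pdf mule1.
Qed.

Definition stdN_moment4 : \bar R := (\int[@stdN R]_x (x ^+ 4)%:E)%E.

(** A second difference of the function [t |-> E (exp (t G^2 / 2))], which is
[(1 - t)^(-1/2)]: on the one hand
[exp (t G^2 / 2) + exp (- t G^2 / 2) >= 2 + t^2 G^4 / 4]; on the other hand the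
sum of the means is at most [2 + 3 t^2 / 4 + t^3].  Dividing by
[t^2 / 4] bounds the moment by [3 + 4 t], for every small [t > 0]. *)
Lemma stdN_moment4_le3 : (stdN_moment4 <= 3%:E)%E.
Proof.
apply/lee_addgt0Pr => e e0.
pose t := Num.min (e / 4) (4^-1).
have t0 : 0 < t by rewrite lt_min divr_gt0//= invr_gt0.
have te : 4 * t <= e.
  have : t <= e / 4 by rewrite ge_min lexx.
  lra.
have t4 : t <= 4^-1 by rewrite ge_min lexx orbT.
clearbody t.
pose a := Num.sqrt (1 - t)^-1.
pose b := Num.sqrt (1 + t)^-1.
have a0 : 0 < a by rewrite sqrtr_gt0 invr_gt0; lra.
have b0 : 0 < b by rewrite sqrtr_gt0 invr_gt0; lra.
have a2 : a ^- 2 = 1 - t by rewrite sqr_sqrtr ?invrK// invr_ge0; lra.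
have b2 : b ^- 2 = 1 + t by rewrite sqr_sqrtr ?invrK// invr_ge0; lra.
have Ia := stdN_expR_sqr a0; have Ib := stdN_expR_sqr b0.
rewrite a2 in Ia; rewrite b2 in Ib.
have mexp (c : R) : measurable_fun setT (fun x : R => (expR (c * x ^+ 2))%:E).
  apply/measurable_EFinP; apply: measurableT_comp; first exact: measurable_expR.
  by apply: measurable_funM => //; exact: measurable_funX.
have m4 : measurable_fun setT (fun x : R => (x ^+ 4)%:E).
  by apply/measurable_EFinP; exact: measurable_funX.
have main : (2%:E + (t ^+ 2 / 4)%:E * stdN_moment4 <= a%:E + b%:E)%E.
  rewrite -Ia -Ib -ge0_integralD//; last 2 first.
  - exact: mexp.
  - exact: mexp.
  have -> : (2%:E = \int[@stdN R]_x (cst 2%:E) x)%E.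
    by rewrite integral_cst// [X in (_ * X)%E](@probability_setT _ _ _ (@stdN R)) mule1.
  rewrite /stdN_moment4 -ge0_integralZl//; last 2 first.
  - by move=> x _; rewrite lee_fin exprn_even_ge0.
  - by rewrite lee_fin divr_ge0// sqr_ge0.
  rewrite -ge0_integralD//; last 3 first.
  - by move=> x _; rewrite lee_fin.
  - by move=> x _; rewrite -EFinM lee_fin mulr_ge0 ?exprn_even_ge0// divr_ge0// sqr_ge0.
  - exact: emeasurable_funM.
  apply: ge0_le_integral => //.
  - move=> x _; rewrite -EFinM lee_fin addr_ge0// mulr_ge0 ?exprn_even_ge0//.
    by rewrite divr_ge0// sqr_ge0.
  - by apply: emeasurable_funD => //; exact: emeasurable_funM.
  - by apply: emeasurable_funD; exact: mexp.
  move=> x _; rewrite -EFinM -!EFinD lee_fin.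
  have /cosh_ge : 0 <= t / 2 * x ^+ 2 by rewrite mulr_ge0 ?sqr_ge0//; lra.
  rewrite (_ : (1 - (1 - t)) / 2 * x ^+ 2 = t / 2 * x ^+ 2); last by field.
  rewrite (_ : (1 - (1 + t)) / 2 * x ^+ 2 = - (t / 2 * x ^+ 2)); last by field.
  by apply: le_trans; rewrite (_ : (t / 2 * x ^+ 2) ^+ 2 = t ^+ 2 / 4 * x ^+ 4)//; field.
have t3 : 0 < t ^+ 3 by rewrite exprn_gt0.
(* The bounds on [a] and [b] are second order Taylor polynomials; [t^3] makes
   up for the positive remainder of [a].  They are checked after squaring. *)
have aA : a <= 1 + t / 2 + 3 / 8 * t ^+ 2 + t ^+ 3.
  set A := (X in _ <= X); have A0 : 0 < A by rewrite /A; have := sqr_ge0 t; nra.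
  have -> : A = Num.sqrt (A ^+ 2) by rewrite sqrtr_sqr ger0_norm// ltW.
  apply: ler_wsqrtr; rewrite -[leLHS]mul1r ler_pdivrMr; last by lra.
  rewrite -subr_ge0 (_ : _ - 1 = t ^+ 3 *
    (11 / 8 - 79 / 64 * t - 25 / 64 * t ^+ 2 + t ^+ 3 / 4 - t ^+ 4)).
    apply: mulr_ge0; first exact: ltW.
    have : t ^+ 4 <= 4^-1.
      rewrite exprS; apply: (le_trans _ t4).
      rewrite -[leRHS]mulr1; apply: ler_wpM2l; first exact: ltW.
      by apply: exprn_ile1; [exact: ltW|lra].
    by have := sqr_ge0 t; nra.
  by rewrite /A; field.
have bB : b <= 1 - t / 2 + 3 / 8 * t ^+ 2.
  set A := (X in _ <= X); have A0 : 0 < A by rewrite /A; have := sqr_ge0 t; nra.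
  have -> : A = Num.sqrt (A ^+ 2) by rewrite sqrtr_sqr ger0_norm// ltW.
  apply: ler_wsqrtr; rewrite -[leLHS]mul1r ler_pdivrMr; last by lra.
  rewrite -subr_ge0 (_ : _ - 1 = t ^+ 3 * (5 / 8 - 15 / 64 * t + 9 / 64 * t ^+ 2)).
    apply: mulr_ge0; first exact: ltW.
    by have := sqr_ge0 t; nra.
  by rewrite /A; field.
(* The first order terms of the two expansions cancel. *)
have main2 : (2%:E + (t ^+ 2 / 4)%:E * stdN_moment4 <= (2 + (t ^+ 2 / 4) * (3 + 4 * t))%:E)%E.
  by apply: (le_trans main); rewrite -EFinD lee_fin; nra.
have k0 : (0 <= stdN_moment4)%E.
  by apply: integral_ge0 => x _; rewrite lee_fin exprn_even_ge0.
move: main2 k0; case: stdN_moment4 => [k| |]//.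
  rewrite -EFinM -!EFinD !lee_fin lerD2l ler_pM2l; last by rewrite divr_gt0// exprn_gt0.
  by move=> *; lra.
by rewrite gt0_muley ?lte_fin ?divr_gt0 ?exprn_gt0// addey.
Qed.

End fourth_moment.

(** * Quartic means of a Gaussian vector *)

Section has_mean.
Context {d : measure_display} {T : measurableType d} {R : realType}.
Variable P : {measure set T -> \bar R}.

(** Integrability is bundled with the value of the integral, so that means of
signed combinations can be computed without further side conditions. *)
Definition has_mean (f : T -> R) (v : R) : Prop :=
  P.-integrable setT (EFin \o f) /\ (\int[P]_x (f x)%:E = v%:E)%E.

Lemma has_meanD f g v w : has_mean f v -> has_mean g w ->
  has_mean (fun x => f x + g x) (v + w).
Proof.
move=> [fi fv] [gi gw]; split; first exact: (integrableD measurableT fi gi).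
under eq_integral do rewrite EFinD.
by rewrite integralD//= fv gw.
Qed.

Lemma has_meanZ c f v : has_mean f v -> has_mean (fun x => c * f x) (c * v).
Proof.
move=> [fi fv]; split; first exact: (integrableZl measurableT c fi).
under eq_integral do rewrite EFinM.
by rewrite integralZl//= fv.
Qed.

Lemma has_mean_sum (I : Type) (r : seq I) (f : I -> T -> R) (v : I -> R) :
  (forall i, has_mean (f i) (v i)) ->
  has_mean (fun x => \sum_(i <- r) f i x) (\sum_(i <- r) v i).
Proof.
move=> h; elim: r => [|i r ih].
  rewrite big_nil (_ : (fun x => _) = cst 0); last first.
    by apply/funext => x; rewrite big_nil.
  by split; [exact: integrable0|rewrite integral0].
rewrite big_cons (_ : (fun x => _) = fun x => f i x + \sum_(j <- r) f j x).
  exact: has_meanD.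
by apply/funext => x; rewrite big_cons.
Qed.

End has_mean.

Definition diffdot (R : realType) (d : nat) (u : 'cV[R]_d)
    (z : d.-tuple R * d.-tuple R) : R :=
  dotv u (colvec z.1) - dotv u (colvec z.2).

Section gaussian_integrals.
Context {R : realType}.

(** [stdN_conv] identifies two laws on the line, hence the integrals of [g]. *)
Lemma ge0_integral_stdN_conv (p q : R) (g : R -> \bar R) :
  measurable_fun setT g -> (forall s, (0 <= g s)%E) ->
  (\int[stdN]_x \int[stdN]_y g (p * x + q * y)%R =
   \int[stdN]_t g (Num.sqrt (p ^+ 2 + q ^+ 2) * t)%R)%E.
Proof.
move=> mg g0.
have mpq : measurable_fun setT (fun z : measurableTypeR R * measurableTypeR R =>
    (p * z.1 + q * z.2 : R)).
  by apply: measurable_funD; apply: measurable_funM.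
have mr : measurable_fun setT (fun t : measurableTypeR R =>
    (Num.sqrt (p ^+ 2 + q ^+ 2) * t : R)).
  exact: measurable_funM.
have mgpq : measurable_fun setT (fun z : measurableTypeR R * measurableTypeR R =>
    g (p * z.1 + q * z.2)) by exact: measurableT_comp.
rewrite -(fubini_tonelli1 (fun z : measurableTypeR R * measurableTypeR R =>
    g (p * z.1 + q * z.2)) mgpq)//.
rewrite -(ge0_integral_image_law (stdN \x stdN)%E mpq mg g0).
rewrite -(ge0_integral_image_law stdN mr mg g0).
apply: eq_measure_integral => A mA _.
transitivity (stdN [set t | A (Num.sqrt (p ^+ 2 + q ^+ 2) * t)]); last by [].
rewrite -stdN_conv//; apply: eq_integral => x _ /=; congr (stdN _).
by apply/seteqP; split => y; rewrite /xsection/= inE.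
Qed.

Variables (d : nat) (gam : probability (d.-tuple R) R).
Hypothesis sg : std_gaussian gam.

Lemma ge0_integral_std_gaussian (u : 'cV[R]_d) (g : R -> \bar R) :
  measurable_fun setT g -> (forall s, (0 <= g s)%E) ->
  (\int[gam]_x g (dotv u (colvec x)) = \int[stdN]_t g (enorm u * t)%R)%E.
Proof.
move=> mg g0.
have mr : measurable_fun setT (fun t : measurableTypeR R => (enorm u * t : R)).
  exact: measurable_funM.
rewrite -(ge0_integral_image_law gam (measurable_dotv u) mg g0).
rewrite -(ge0_integral_image_law stdN mr mg g0).
by apply: eq_measure_integral => A mA _; exact: sg.
Qed.

Lemma measurable_diffdot (u : 'cV[R]_d) : measurable_fun setT (diffdot u).
Proof.
apply: measurable_funB.
  exact: (measurableT_comp (measurable_dotv u) measurable_fst).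
exact: (measurableT_comp (measurable_dotv u) measurable_snd).
Qed.

(** The difference of two independent copies of [u . Z] has the law of
[sqrt 2 |u| G], whose fourth moment is [4 |u|^4] times that of [G]. *)
Lemma integral_diffdot4 (u : 'cV[R]_d) :
  (\int[gam \x gam]_z (diffdot u z ^+ 4)%:E = (4 * enorm u ^+ 4)%:E * stdN_moment4)%E.
Proof.
have m4 : measurable_fun setT (fun s : R => (s ^+ 4)%:E).
  by apply/measurable_EFinP; exact: measurable_funX.
have p4 (s : R) : (0 <= (s ^+ 4)%:E)%E by rewrite lee_fin exprn_even_ge0.
have md : measurable_fun setT (fun z => (diffdot u z ^+ 4)%:E).
  by apply: (measurableT_comp m4); exact: measurable_diffdot.
rewrite fubini_tonelli1//= /fubini_F /diffdot /=.
pose G s := (\int[@stdN R]_t ((s - enorm u * t) ^+ 4)%:E)%E.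
have mG2 : measurable_fun setT (fun z : measurableTypeR R * measurableTypeR R =>
    ((z.1 - enorm u * z.2) ^+ 4)%:E).
  apply: (measurableT_comp m4); apply: measurable_funB => //.
  exact: measurable_funM.
have mG : measurable_fun setT G.
  exact: (@measurable_fun_fubini_tonelli_F _ _ (measurableTypeR R)
    (measurableTypeR R) _ (@stdN R) _ mG2 (fun z => p4 _)).
transitivity (\int[gam]_x G (dotv u (colvec x)))%E.
  apply: eq_integral => x _.
  rewrite (ge0_integral_std_gaussian u
    (g := fun s => ((dotv u (colvec x) - s) ^+ 4)%:E))//.
  apply: (measurableT_comp m4); exact: measurable_funB.
rewrite (ge0_integral_std_gaussian u mG); last first.
  by move=> s; apply: integral_ge0.
rewrite /G.
transitivity (\int[@stdN R]_x \int[@stdN R]_y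
    ((enorm u * x + (- enorm u) * y) ^+ 4)%:E)%E.
  by apply: eq_integral => x _; apply: eq_integral => y _; rewrite mulNr.
rewrite (ge0_integral_stdN_conv _ _ m4 p4).
rewrite /stdN_moment4 -ge0_integralZl//; last first.
  by rewrite lee_fin mulr_ge0// exprn_even_ge0.
apply: eq_integral => x _; rewrite -EFinM exprMn sqrrN; congr (_ * _)%:E.
rewrite -[4%N]/(2 * 2)%N exprM sqr_sqrtr ?addr_ge0 ?sqr_ge0//.
by rewrite !exprM; ring.
Qed.

Lemma quartic_mean : exists2 k : R, k <= 3 &
  forall u, has_mean (gam \x gam)%E (fun z => diffdot u z ^+ 4) (4 * enorm u ^+ 4 * k).
Proof.
have k0 : (0 <= @stdN_moment4 R)%E.
  by apply: integral_ge0 => x _; rewrite lee_fin exprn_even_ge0.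
have := @stdN_moment4_le3 R; have := integral_diffdot4; move: k0.
case: stdN_moment4 => [k k0 id4 k3|_ _ //|//].
exists k; first by rewrite -lee_fin.
move=> u; split; last by rewrite id4.
apply/integrableP; split.
  by apply/measurable_EFinP; apply: measurable_funX; exact: measurable_diffdot.
under eq_integral do rewrite /= ger0_norm ?exprn_even_ge0//.
by rewrite id4 -EFinM ltry.
Qed.

End gaussian_integrals.

Section quadratic_form_mean.
Context {R : realType} {d : nat}.
Implicit Types u : 'cV[R]_d.

Variables (gam : probability (d.-tuple R) R) (k : R).
Hypothesis qm : forall u, has_mean (gam \x gam)%E
  (fun z => diffdot u z ^+ 4) (4 * enorm u ^+ 4 * k).

Let w (i : 'I_d) (z : d.-tuple R * d.-tuple R) : R := tnth z.1 i - tnth z.2 i.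

(** Polarization:
[12 a^2 b^2 = (a + b)^4 + (a - b)^4 - 2 a^4 - 2 b^4], applied to coordinates. *)
Lemma mean_sqr_sqr (i j : 'I_d) : has_mean (gam \x gam)%E
  (fun z => w i z ^+ 2 * w j z ^+ 2) (4 / 3 * k * (1 + 2 * (i == j)%:R)).
Proof.
pose e i : 'cV[R]_d := delta_mx i ord0.
(* For [i = j] the form [u2] vanishes and the identity still holds. *)
pose u1 := e i + e j; pose u2 := e i + (-1) *: e j.
have := has_meanZ 12^-1 (has_meanD (has_meanD (qm u1) (qm u2))
  (has_meanZ (-2) (has_meanD (qm (e i)) (qm (e j))))).
congr has_mean.
  apply/funext => z; rewrite /diffdot /u1 /u2 !dotvDl !dotvZl !dotv_delta_colvec /w.
  by field.
have e4 u : enorm u ^+ 4 = dotv u u ^+ 2.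
  by rewrite -sqr_enorm -exprM.
rewrite !e4 /u1 /u2 !(dotvDl, dotvDr, dotvZl, dotvZr) !dotv_deltal !mxE !eqxx.
rewrite (eq_sym j i) !andbT.
by case: (i == j) => /=; field.
Qed.

Lemma mean_quadratic_form_sqr (c : 'I_d -> R) : has_mean (gam \x gam)%E
  (fun z => (\sum_i c i * w i z ^+ 2) ^+ 2)
  (4 / 3 * k * ((\sum_i c i) ^+ 2 + 2 * \sum_i c i ^+ 2)).
Proof.
have := @has_mean_sum _ _ _ (gam \x gam)%E _ (index_enum 'I_d) _ _
  (fun i => @has_mean_sum _ _ _ (gam \x gam)%E _ (index_enum 'I_d) _ _
  (fun j => has_meanZ (c i * c j) (mean_sqr_sqr i j))).
congr has_mean.
  apply/funext => z; rewrite [RHS]expr2 mulr_suml; apply: eq_bigr => i _.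
  by rewrite mulr_sumr; apply: eq_bigr => j _; ring.
rewrite expr2 mulr_suml mulr_sumr -big_split/= mulr_sumr.
apply: eq_bigr => i _; rewrite mulr_sumr.
transitivity (\sum_j (4 / 3 * k * (c i * c j)) +
    \sum_j (4 / 3 * k * 2 * c i * (c j * (i == j)%:R))).
  by rewrite -big_split/=; apply: eq_bigr => j _; ring.
have -> : \sum_j (4 / 3 * k * 2 * c i * (c j * (i == j)%:R)) =
    4 / 3 * k * 2 * c i * c i.
  rewrite (bigD1 i)//= eqxx mulr1 big1 ?addr0// => j ji.
  by rewrite eq_sym (negbTE ji) !mulr0.
by rewrite -!mulr_sumr; ring.
Qed.

End quadratic_form_mean.

(** * Inner product of sorted vectors *)

Section sorted_vectors.
Context {R : realType} {m : nat}.
Variables a b : 'I_m -> R.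
Hypotheses (a0 : forall i, 0 <= a i) (b0 : forall i, 0 <= b i).
Hypotheses (am : forall i j : 'I_m, (i <= j)%N -> a j <= a i)
           (bm : forall i j : 'I_m, (i <= j)%N -> b j <= b i).

(** The double sum of the nonnegative terms [(a_i - a_j)(b_i - b_j)] is twice
the difference of the two sides. *)
Lemma chebyshev_sum :
  (\sum_i a i) * (\sum_i b i) <= m%:R * \sum_i a i * b i.
Proof.
have h : 0 <= \sum_i \sum_j (a i - a j) * (b i - b j).
  rewrite sumr_ge0// => i _; rewrite sumr_ge0// => j _.
  have [ij|/ltnW ij] := leqP i j.
    by have := am ij; have := bm ij; nra.
  by have := am ij; have := bm ij; nra.
have E : \sum_i \sum_j (a i - a j) * (b i - b j) =
    2 * (m%:R * (\sum_i a i * b i)) - 2 * ((\sum_i a i) * (\sum_i b i)).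
  transitivity (\sum_i \sum_(j < m) (a i * b i + a j * b j) -
      \sum_i \sum_j (a i * b j + a j * b i)).
    rewrite -sumrB; apply: eq_bigr => i _; rewrite -sumrB.
    by apply: eq_bigr => j _; ring.
  congr (_ - _).
    under eq_bigr do rewrite big_split/= sumr_const card_ord -mulr_natl.
    by rewrite big_split/= sumr_const card_ord -mulr_natl -mulr_sumr; ring.
  under eq_bigr do rewrite big_split/= -mulr_sumr -mulr_suml.
  by rewrite big_split/= -mulr_suml -mulr_sumr; ring.
by rewrite E in h; lra.
Qed.

(** Let [S] be the inner product.  The leading term gives [a_0 b_0 <= S],
Chebyshev's inequality gives [(sum a)(sum b) <= m S], and
[sum a^2 <= a_0 sum a], likewise for [b]; multiplying,
[(sum a^2)(sum b^2) <= m S^2]. *)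
Lemma sorted_inner_product_ge :
  Num.sqrt (\sum_i a i ^+ 2) * Num.sqrt (\sum_i b i ^+ 2) <=
  Num.sqrt m%:R * \sum_i a i * b i.
Proof.
have S0 : 0 <= \sum_i a i * b i by rewrite sumr_ge0// => i _; rewrite mulr_ge0.
rewrite -sqrtrM ?sumr_ge0// => [|i _]; last exact: sqr_ge0.
rewrite -[in leRHS](ger0_norm S0) -sqrtr_sqr -sqrtrM//.
apply: ler_wsqrtr.
have cs := chebyshev_sum.
move: S0 cs.
case: m a b a0 b0 am bm => [|p] a' b' a'0 b'0 a'm b'm.
  by rewrite !big_ord0 !mul0r.
set S := \sum_i a' i * b' i => S0 cs.
have top : a' ord0 * b' ord0 <= S.
  rewrite /S big_ord_recl lerDl sumr_ge0// => i _; exact: mulr_ge0.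
have A2 : \sum_i a' i ^+ 2 <= a' ord0 * \sum_i a' i.
  rewrite mulr_sumr; apply: ler_sum => i _; rewrite expr2.
  by apply: ler_wpM2r => //; exact: a'm.
have B2 : \sum_i b' i ^+ 2 <= b' ord0 * \sum_i b' i.
  rewrite mulr_sumr; apply: ler_sum => i _; rewrite expr2.
  by apply: ler_wpM2r => //; exact: b'm.
apply: (@le_trans _ _ ((a' ord0 * \sum_i a' i) * (b' ord0 * \sum_i b' i))).
  by apply: ler_pM => //; apply: sumr_ge0 => i _; exact: sqr_ge0.
rewrite mulrACA expr2 [leRHS]mulrCA.
by apply: ler_pM => //; apply: mulr_ge0 => //; apply: sumr_ge0.
Qed.

End sorted_vectors.

(** * Diagonal matrices *)

Lemma widen_inj n m (h : (n <= m)%N) : injective (widen_ord h).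
Proof. by move=> i j /(congr1 val) /= ij; exact: val_inj. Qed.

Section diagonal.
Context {R : realType}.

Lemma dotv_isometry p d (P : 'M[R]_(p, d)) (u v : 'cV[R]_d) :
  P^T *m P = 1%:M -> dotv (P *m u) (P *m v) = dotv u v.
Proof. by move=> PP; rewrite /dotv trmx_mul mulmxA -(mulmxA u^T) PP mulmx1. Qed.

Lemma diag_mx_diag d (D : 'M[R]_d) : is_diag_mx D ->
  D = diag_mx (\row_i D i i).
Proof.
move=> /is_diag_mxP dD; apply/matrixP => i j; rewrite !mxE.
by case: eqVneq => [->|ij]; rewrite ?mulr1n// mulr0n dD.
Qed.

Lemma sqr_frobenius p q (M : 'M[R]_(p, q)) :
  frobenius M ^+ 2 = \sum_i \sum_j M i j ^+ 2.
Proof.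
have E : \tr (M^T *m M) = \sum_i \sum_j M i j ^+ 2.
  rewrite /mxtrace exchange_big; apply: eq_bigr => i _; rewrite mxE.
  by apply: eq_bigr => j _; rewrite !mxE expr2.
rewrite /frobenius sqr_sqrtr E//.
by rewrite sumr_ge0// => i _; rewrite sumr_ge0// => j _; exact: sqr_ge0.
Qed.

Lemma frobenius_ge0 p q (M : 'M[R]_(p, q)) : 0 <= frobenius M.
Proof. exact: sqrtr_ge0. Qed.

Lemma sqr_frobenius_diag d (D : 'M[R]_d) : is_diag_mx D ->
  frobenius D ^+ 2 = \sum_i D i i ^+ 2.
Proof.
move=> /is_diag_mxP dD; rewrite sqr_frobenius; apply: eq_bigr => i _.
rewrite (bigD1 i)//= big1 ?addr0// => j ji; rewrite dD ?expr0n//.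
by rewrite eq_sym.
Qed.

Lemma frobenius_conj d (P D : 'M[R]_d) : P^T *m P = 1%:M ->
  frobenius (P *m D *m P^T) = frobenius D.
Proof.
move=> PP; rewrite /frobenius; congr Num.sqrt.
have -> : (P *m D *m P^T)^T *m (P *m D *m P^T) = P *m (D^T *m D *m P^T).
  by rewrite !trmx_mul trmxK !mulmxA -(mulmxA _ P^T P) PP mulmx1.
by rewrite mxtrace_mulC -(mulmxA (D^T *m D)) PP mulmx1.
Qed.

Lemma diag_psd_ge0 d (S P D : 'M[R]_d) : S = P *m D *m P^T ->
  P^T *m P = 1%:M -> (forall u, 0 <= dotv u (S *m u)) ->
  forall i, 0 <= D i i.
Proof.
move=> SE PP psd i; have := psd (P *m delta_mx i ord0).
rewrite SE -!mulmxA (mulmxA P^T) PP mul1mx dotv_isometry//.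
by rewrite dotv_deltal -colE mxE.
Qed.

Definition sqrt_diag d (D : 'M[R]_d) : 'M[R]_d :=
  diag_mx (\row_i Num.sqrt (D i i)).

Lemma sqrt_diag_sqr d (D : 'M[R]_d) : is_diag_mx D -> (forall i, 0 <= D i i) ->
  sqrt_diag D *m (sqrt_diag D)^T = D.
Proof.
move=> dD D0; rewrite [RHS]diag_mx_diag// /sqrt_diag tr_diag_mx mulmx_diag.
by congr diag_mx; apply/rowP => i; rewrite !mxE -expr2 sqr_sqrtr.
Qed.

Lemma dotv_sqrt_diag d (D : 'M[R]_d) (x : 'cV[R]_d) : (forall i, 0 <= D i i) ->
  dotv (sqrt_diag D *m x) (sqrt_diag D *m x) = \sum_i D i i * x i ord0 ^+ 2.
Proof.
move=> D0; rewrite dotvE; apply: eq_bigr => i _.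
by rewrite /sqrt_diag mul_diag_mx !mxE mulrACA -!expr2 sqr_sqrtr.
Qed.

Definition coord_proj n m (h : (n <= m)%N) : 'M[R]_(n, m) :=
  \matrix_(i, j) (widen_ord h i == j)%:R.

Lemma coord_projE n m (h : (n <= m)%N) (x : 'cV[R]_m) i :
  (coord_proj h *m x) i ord0 = x (widen_ord h i) ord0.
Proof.
rewrite mxE (bigD1 (widen_ord h i))//= mxE eqxx mul1r big1 ?addr0// => j ji.
by rewrite mxE eq_sym (negbTE ji) mul0r.
Qed.

Lemma coord_proj_tr n m (h : (n <= m)%N) :
  coord_proj h *m (coord_proj h)^T = 1%:M.
Proof.
apply/matrixP => i j; rewrite !mxE (bigD1 (widen_ord h i))//= !mxE eqxx mul1r.
rewrite big1 ?addr0 => [|k ki]; last by rewrite !mxE eq_sym (negbTE ki) mul0r.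
by rewrite eq_sym (inj_eq (@widen_inj _ _ h)).
Qed.

(** The diagonal of [D] extended by zeros, which lets spectra of different
lengths be compared as vectors of the same space. *)
Definition padded_diag n m (h : (n <= m)%N) (D : 'M[R]_n) (i : 'I_m) : R :=
  \sum_j D j j * (widen_ord h j == i)%:R.

Lemma sum_padded_diag n m (h : (n <= m)%N) (D : 'M[R]_n) (f : 'I_m -> R) :
  \sum_i padded_diag h D i * f i = \sum_j D j j * f (widen_ord h j).
Proof.
under eq_bigr do rewrite /padded_diag mulr_suml.
rewrite exchange_big; apply: eq_bigr => j _.
rewrite (bigD1 (widen_ord h j))//= eqxx mulr1 big1 ?addr0// => i ij.
by rewrite eq_sym (negbTE ij) mulr0 mul0r.
Qed.

Lemma padded_diag_widen n m (h : (n <= m)%N) (D : 'M[R]_n) j :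
  padded_diag h D (widen_ord h j) = D j j.
Proof.
rewrite /padded_diag (bigD1 j)//= eqxx mulr1 big1 ?addr0// => i ij.
by rewrite (inj_eq (@widen_inj _ _ h)) (negbTE ij) mulr0.
Qed.

Lemma sum_sqr_padded_diag n m (h : (n <= m)%N) (D : 'M[R]_n) :
  \sum_i padded_diag h D i ^+ 2 = \sum_j D j j ^+ 2.
Proof.
under eq_bigr do rewrite expr2.
rewrite sum_padded_diag; apply: eq_bigr => j _.
by rewrite padded_diag_widen expr2.
Qed.

Lemma padded_diag_out n m (h : (n <= m)%N) (D : 'M[R]_n) (i : 'I_m) :
  (n <= i)%N -> padded_diag h D i = 0.
Proof.
move=> ni; rewrite /padded_diag big1// => j _.
by rewrite -val_eqE/= ltn_eqF ?mulr0// (leq_trans (ltn_ord j)).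
Qed.

Lemma padded_diag_ge0 n m (h : (n <= m)%N) (D : 'M[R]_n) i :
  (forall j, 0 <= D j j) -> 0 <= padded_diag h D i.
Proof. by move=> D0; rewrite sumr_ge0// => j _; rewrite mulr_ge0. Qed.

Lemma padded_diag_sorted n m (h : (n <= m)%N) (D : 'M[R]_n) :
  (forall j, 0 <= D j j) -> (forall i j : 'I_n, (i <= j)%N -> D j j <= D i i) ->
  forall i j : 'I_m, (i <= j)%N -> padded_diag h D j <= padded_diag h D i.
Proof.
move=> D0 sD i j ij; have [jn|nj] := ltnP j n; last first.
  by rewrite (padded_diag_out h D nj) padded_diag_ge0.
have [i' iE] : exists i', i = widen_ord h i'.
  by exists (Ordinal (leq_ltn_trans ij jn)); apply/val_inj.
have [j' jE] : exists j', j = widen_ord h j'.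
  by exists (Ordinal jn); apply/val_inj.
by move: ij; rewrite iE jE !padded_diag_widen; exact: sD.
Qed.

End diagonal.

(** * The coupling *)

Section tuples.
Context {R : realType}.

Definition tuple_of_colvec d (v : 'cV[R]_d) : d.-tuple R := [tuple v i ord0 | i < d].

Lemma tuple_of_colvecK d (v : 'cV[R]_d) : colvec (tuple_of_colvec v) = v.
Proof. by apply/colP => i; rewrite mxE tnth_mktuple. Qed.

Lemma colvec_cat p q (x : p.-tuple R) (y : q.-tuple R) :
  colvec [tuple of x ++ y] = col_mx (colvec x) (colvec y).
Proof.
apply/colP => i; rewrite mxE; case: (split_ordP i) => j ->.
  by rewrite tnth_lshift col_mxEu mxE.
by rewrite tnth_rshift col_mxEd mxE.
Qed.

Definition affine_tuple d e (a : 'cV[R]_e) (B : 'M[R]_(e, d)) (x : d.-tuple R) :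
  e.-tuple R := tuple_of_colvec (a + B *m colvec x).

Lemma affine_tupleB d e (a : 'cV[R]_e) (B : 'M[R]_(e, d)) (x y : d.-tuple R) :
  colvec (affine_tuple a B x) - colvec (affine_tuple a B y) =
  B *m (colvec x - colvec y).
Proof. by rewrite !tuple_of_colvecK opprD addrACA subrr add0r mulmxBr. Qed.

Lemma measurable_affine_tuple d e (a : 'cV[R]_e) (B : 'M[R]_(e, d)) :
  measurable_fun setT (affine_tuple a B).
Proof.
apply/measurable_fun_tnthP => i.
rewrite (_ : _ \o _ = fun x => a i ord0 + dotv (row i B)^T (colvec x)).
  by apply: measurable_funD => //; exact: measurable_dotv.
by apply/funext => x /=; rewrite tnth_mktuple mxE /dotv trmxK -row_mul [in RHS]mxE.
Qed.

End tuples.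

Lemma measurable_sqr_dist (R : realType) (disp : measure_display)
    (T : measurableType disp) d (f g : T -> d.-tuple R) :
  measurable_fun setT f -> measurable_fun setT g ->
  measurable_fun setT (fun x => enorm (colvec (f x) - colvec (g x)) ^+ 2).
Proof.
move=> mf mg.
rewrite (_ : (fun x => _) =
    fun x => \sum_i (tnth (f x) i - tnth (g x) i) ^+ 2); last first.
  apply/funext => x; rewrite sqr_enorm dotvE.
  by apply: eq_bigr => i _; rewrite !mxE expr2.
apply: measurable_sum => i; apply: measurable_funX; apply: measurable_funB.
  exact: (measurableT_comp (measurable_tnth i) mf).
exact: (measurableT_comp (measurable_tnth i) mg).
Qed.

Section coupling.
Context {R : realType} {m n : nat}.
Variables (gam : probability (m.-tuple R) R).
Hypothesis sg : std_gaussian gam.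
Variables (mu : probability (m.-tuple R) R) (nu : probability (n.-tuple R) R).
Variables (m0 : 'cV[R]_m) (m1 : 'cV[R]_n).
Variables (B0 : 'M[R]_m) (B1 : 'M[R]_(n, m)).
Hypotheses (hmu : is_gaussian mu m0 (B0 *m B0^T))
           (hnu : is_gaussian nu m1 (B1 *m B1^T)).

Let F (z : m.-tuple R) : m.-tuple R * n.-tuple R :=
  (affine_tuple m0 B0 z, affine_tuple m1 B1 z).

Let mF : measurable_fun setT F.
Proof. by apply: measurable_fun_pair; exact: measurable_affine_tuple. Qed.

Definition gaussian_coupling : probability (m.-tuple R * n.-tuple R)%type R :=
  image_law gam mF.

Lemma gaussian_coupling_is_coupling : is_coupling mu nu gaussian_coupling.
Proof.
split=> A mA.
- have g0 : is_gaussian (image_law gam (measurable_affine_tuple m0 B0)) m0 (B0 *m B0^T).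
    apply: (std_gaussian_affine sg (f := affine_tuple m0 B0)) => // x.
    exact: tuple_of_colvecK.
  rewrite -(gaussian_unique g0 hmu mA) /= /distribution /pushforward/=.
  by congr (gam _); apply/seteqP; split => z //= [].
- have g1 : is_gaussian (image_law gam (measurable_affine_tuple m1 B1)) m1 (B1 *m B1^T).
    apply: (std_gaussian_affine sg (f := affine_tuple m1 B1)) => // x.
    exact: tuple_of_colvecK.
  rewrite -(gaussian_unique g1 hnu mA) /= /distribution /pushforward/=.
  by congr (gam _); apply/seteqP; split => z //= [].
Qed.

Lemma gaussian_coupling_jointly_gaussian : jointly_gaussian gaussian_coupling.
Proof.
exists (col_mx m0 m1), (col_mx B0 B1 *m (col_mx B0 B1)^T).
apply: (std_gaussian_affine sg (f := fun z => [tuple of (F z).1 ++ (F z).2])) => //.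
by move=> x; rewrite colvec_cat !tuple_of_colvecK mul_col_mx add_col_mx.
Qed.

(** The cost only involves differences of two copies, so that the translations
[m0] and [m1] cancel. *)
Lemma gw_cost_gaussian_coupling :
  gw_cost gaussian_coupling = (\int[gam \x gam]_z
    ((dotv (B0 *m (colvec z.1 - colvec z.2)) (B0 *m (colvec z.1 - colvec z.2))
      - dotv (B1 *m (colvec z.1 - colvec z.2)) (B1 *m (colvec z.1 - colvec z.2)))
     ^+ 2)%:E)%E.
Proof.
pose h (z z' : m.-tuple R * n.-tuple R) : \bar R :=
  ((enorm (colvec z.1 - colvec z'.1) ^+ 2
    - enorm (colvec z.2 - colvec z'.2) ^+ 2) ^+ 2)%:E.
have h0 z z' : (0 <= h z z')%E by rewrite lee_fin sqr_ge0.
have mh (disp : measure_display) (T : measurableType disp)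
    (f g : T -> m.-tuple R * n.-tuple R) :
    measurable_fun setT f -> measurable_fun setT g ->
    measurable_fun setT (fun x => h (f x) (g x)).
  move=> mf mg; apply/measurable_EFinP; apply: measurable_funX.
  by apply: measurable_funB; apply: measurable_sqr_dist;
    do ?[exact: (measurableT_comp measurable_fst)
        |exact: (measurableT_comp measurable_snd)].
(* The inner integral is transported first, so that its measurability as a
   function of [z] is known when the outer one is transported. *)
pose G z := (\int[gam]_y h z (F y))%E.
have mG : measurable_fun setT G.
  apply: (@measurable_fun_fubini_tonelli_F _ _ _ _ _ gam
    (fun z : (m.-tuple R * n.-tuple R) * m.-tuple R => h z.1 (F z.2))) => //.
  by apply: mh => //; exact: (measurableT_comp mF measurable_snd).
rewrite /gw_cost -/h.
transitivity (\int[gaussian_coupling]_z G z)%E.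
  apply: eq_integral => z _.
  by rewrite (ge0_integral_image_law gam mF (g := h z))//; exact: mh.
rewrite [LHS](ge0_integral_image_law gam mF mG); last first.
  by move=> z; exact: integral_ge0.
transitivity (\int[gam \x gam]_z h (F z.1) (F z.2))%E.
  rewrite fubini_tonelli1//; apply: mh.
    exact: (measurableT_comp mF measurable_fst).
  exact: (measurableT_comp mF measurable_snd).
by apply: eq_integral => z _; rewrite /h /F/= !sqr_enorm !affine_tupleB.
Qed.

End coupling.

(** * The bound *)

(** The excess of the cost of the coupling over [LGW_2^2]: the traces and the
squared norms cancel, and only the product of the norms and the inner product of
the spectra remain. *)
Lemma gw_identity (R : realType) (m n : nat) (hnm : (n <= m)%N)
    (D0 : 'M[R]_m) (D1 : 'M[R]_n) (c := fun i => D0 i i - padded_diag hnm D1 i) :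
  is_diag_mx D0 -> is_diag_mx D1 ->
  4 * ((\sum_i c i) ^+ 2 + 2 * \sum_i c i ^+ 2) - LGW2sq hnm D0 D1 =
  8 * (frobenius D0 * frobenius D1 - \sum_i D0 i i * padded_diag hnm D1 i).
Proof.
move=> dD0 dD1.
have dL : is_diag_mx (lead_submx hnm D0).
  apply/is_diag_mxP => i j ij; rewrite mxE (is_diag_mxP dD0)//.
have dLD : is_diag_mx (lead_submx hnm D0 - D1).
  apply/is_diag_mxP => i j ij.
  by rewrite [LHS]mxE [X in _ + X]mxE (is_diag_mxP dL)// (is_diag_mxP dD1)// subrr.
rewrite /LGW2sq (sqr_frobenius_diag dL) (sqr_frobenius_diag dLD).
have X := sqr_frobenius_diag dD0; have Y := sqr_frobenius_diag dD1.
have Sb : \sum_i padded_diag hnm D1 i = \tr D1.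
  have := sum_padded_diag hnm D1 (fun=> 1).
  by under eq_bigr do rewrite mulr1; under [RHS]eq_bigr do rewrite mulr1.
have Sab : \sum_i D0 i i * padded_diag hnm D1 i =
    \sum_j lead_submx hnm D0 j j * D1 j j.
  under eq_bigr do rewrite mulrC.
  rewrite sum_padded_diag; apply: eq_bigr => j _.
  by rewrite mxE mulrC.
have Sc : \sum_i c i = \tr D0 - \tr D1 by rewrite sumrB Sb.
have sqrB_sum (I : finType) (f g : I -> R) : \sum_i (f i - g i) ^+ 2 =
    \sum_i f i ^+ 2 + \sum_i g i ^+ 2 - 2 * \sum_i f i * g i.
  rewrite mulr_sumr -big_split/= -sumrB; apply: eq_bigr => i _; ring.
have Sc2 : \sum_i c i ^+ 2 = frobenius D0 ^+ 2 + frobenius D1 ^+ 2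
    - 2 * \sum_i D0 i i * padded_diag hnm D1 i.
  by rewrite sqrB_sum sum_sqr_padded_diag X Y.
have SL : \sum_i (lead_submx hnm D0 - D1) i i ^+ 2 =
    \sum_i lead_submx hnm D0 i i ^+ 2 + frobenius D1 ^+ 2
    - 2 * \sum_i D0 i i * padded_diag hnm D1 i.
  rewrite Y Sab -sqrB_sum; apply: eq_bigr => i _.
  by rewrite [X in X ^+ 2 = _]mxE [X in (_ + X) ^+ 2 = _]mxE.
by rewrite Sc Sc2 SL; ring.
Qed.

Theorem proposition5p1 (R : realType) (m n : nat) (hn : (0 < n)%N)
    (hnm : (n <= m)%N)
    (mu : probability (m.-tuple R) R) (nu : probability (n.-tuple R) R)
    (m0 : 'cV[R]_m) (m1 : 'cV[R]_n)
    (Sigma0 : 'M[R]_m) (Sigma1 : 'M[R]_n)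
    (hmu : is_gaussian mu m0 Sigma0) (hnu : is_gaussian nu m1 Sigma1)
    (P0 D0 : 'M[R]_m) (P1 D1 : 'M[R]_n)
    (hD0 : ordered_diagonalization Sigma0 P0 D0)
    (hD1 : ordered_diagonalization Sigma1 P1 D1) :
  (GGW2sq mu nu - (LGW2sq hnm D0 D1)%:E
   <= (8 * frobenius Sigma0 * frobenius Sigma1
       * (1 - 1 / Num.sqrt m%:R))%:E)%E.
Proof.
have [S0E PP0 dD0 sD0] := hD0; have [S1E PP1 dD1 sD1] := hD1.
have D0p : forall i, 0 <= D0 i i.
  by have [_ psd _] := hmu; exact: diag_psd_ge0 S0E PP0 psd.
have D1p : forall i, 0 <= D1 i i.
  by have [_ psd _] := hnu; exact: diag_psd_ge0 S1E PP1 psd.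
pose B0 := P0 *m sqrt_diag D0.
pose B1 := P1 *m sqrt_diag D1 *m @coord_proj R n m hnm.
have B0E : B0 *m B0^T = Sigma0.
  by rewrite S0E /B0 trmx_mul -!mulmxA (mulmxA (sqrt_diag D0)) sqrt_diag_sqr.
have B1E : B1 *m B1^T = Sigma1.
  rewrite S1E /B1 !trmx_mul -!mulmxA (mulmxA (coord_proj _)) coord_proj_tr mul1mx.
  by rewrite (mulmxA (sqrt_diag D1)) sqrt_diag_sqr.
rewrite -B0E in hmu; rewrite -B1E in hnu.
have [gam sg] := @std_gaussian_exists R m.
have [k k3 qm] := quartic_mean sg.
pose c i := D0 i i - padded_diag hnm D1 i.
have cost : gw_cost (gaussian_coupling gam m0 m1 B0 B1) =
    (4 / 3 * k * ((\sum_i c i) ^+ 2 + 2 * \sum_i c i ^+ 2))%:E.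
  rewrite gw_cost_gaussian_coupling.
  rewrite -(mean_quadratic_form_sqr qm c).2.
  apply: eq_integral => z _; congr (_ ^+ 2)%:E.
  set w := colvec z.1 - colvec z.2.
  have wE i : w i ord0 = tnth z.1 i - tnth z.2 i by rewrite !mxE.
  rewrite /B0 -mulmxA dotv_isometry// dotv_sqrt_diag//.
  rewrite /B1 -!mulmxA dotv_isometry// dotv_sqrt_diag//.
  under [X in _ - X]eq_bigr do rewrite coord_projE.
  rewrite -(sum_padded_diag hnm D1 (fun i => w i ord0 ^+ 2)) -sumrB.
  by apply: eq_bigr => i _; rewrite wE mulrBl.
have GGW_le : (GGW2sq mu nu <= (4 * ((\sum_i c i) ^+ 2 + 2 * \sum_i c i ^+ 2))%:E)%E.
  apply: (@le_trans _ _ (gw_cost (gaussian_coupling gam m0 m1 B0 B1))).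
    apply: ereal_inf_lbound; exists (gaussian_coupling gam m0 m1 B0 B1) => //.
    split; [exact: gaussian_coupling_is_coupling|].
    exact: gaussian_coupling_jointly_gaussian.
  (* The cost is increasing in the fourth moment [k], which is at most [3]. *)
  rewrite cost lee_fin; apply: ler_wpM2r; last by lra.
  by rewrite addr_ge0 ?sqr_ge0// mulr_ge0// sumr_ge0// => i _; exact: sqr_ge0.
rewrite leeBlDr//; apply: (le_trans GGW_le); rewrite -EFinD lee_fin -lerBlDr.
rewrite gw_identity// S0E S1E !frobenius_conj// -!mulrA; apply: ler_wpM2l => //.
have m_gt0 : 0 < Num.sqrt m%:R :> R.
  by rewrite sqrtr_gt0 ltr0n (leq_trans hn).
have := @sorted_inner_product_ge R m (fun i => D0 i i) (padded_diag hnm D1) D0p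
  (fun i => padded_diag_ge0 hnm i D1p) sD0 (padded_diag_sorted hnm D1p sD1).
rewrite sum_sqr_padded_diag -!sqr_frobenius_diag// !sqrtr_sqr !ger0_norm ?frobenius_ge0// => key.
have -> (s f g : R) : f * (g * (1 - 1 / s)) = f * g - f * g / s by ring.
by rewrite lerD2l lerN2 ler_pdivrMr// [leRHS]mulrC.
Qed.
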